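(* Let $\mathbf{k}$ be a field and let $H$ be a Hopf algebra over $\mathbf{k}$ such that the group $G$ of all group-like elements of $H$ is abelian and $H$ is generated as an algebra by $G$ and by skew primitive semi-invariants $a_1,\ldots,a_n$. Fix positive integer degrees $d_1,\ldots,d_n$ of $a_1,\ldots,a_n$. Then the set of all monotonic restricted $G$-super-words in hard super-letters constitutes a basis of $H$ over $\mathbf{k}$. In other words, the elements $g[u_1]^{n_1}[u_2]^{n_2}\cdots[u_k]^{n_k}$ with $g\in G$, $k\ge 0$, $u_1<u_2<\cdots<u_k$ standard words such that every $[u_i]$ is hard, and each $n_i\geq 1$ less than the height of $[u_i]$, form a basis of $H$.
   Context: Setting. ''Skew primitive semi-invariant'' means: for each $i$ there are $g_i\in G$ and a character (group homomorphism) $\chi^i:G\to\mathbf{k}^*$ with $\Delta(a_i)=a_i\otimes 1+g_i\otimes a_i$ and $a_i g=\chi^i(g)\,g a_i$ for all $g\in G$. Words. Consider words in the alphabet $a_1,\ldots,a_n$, ordered lexicographically with $a_1>a_2>\cdots>a_n$: two words are compared from left to right at the first distinct letter, and a proper beginning of a word is greater than that word. For a word $u$ let $g_u\in G$ and the character $\chi^u$ be obtained from $u$ by replacing each letter $a_i$ by $g_i$, respectively by $\chi^i$, and put $p_{uv}=\chi^u(g_v)$. A word $u$ with $m_i$ occurrences of $a_i$ has constitution $(m_1,\ldots,m_n)$ and degree $\deg(u)=m_1d_1+\cdots+m_nd_n$. Standard words. A nonempty word $u$ is standard if $u>u_2u_1$ for each factorization $u=u_1u_2$ into nonempty words. A nonassociative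 (fully bracketed) word $[u]$ is standard if: (1) the word $u$ obtained by erasing brackets is standard; (2) if $[u]=[[v][w]]$ then $[v]$, $[w]$ are standard nonassociative words; (3) if $[u]=[[[v_1][v_2]][w]]$ then $v_2\le w$. By a theorem of Shirshov each standard word has a unique bracketing that is a standard nonassociative word (for $u$ of length $\ge 2$ it is $[[v][w]]$ with $u=vw$, $v,w$ standard and $v$ of least possible length). Super-letters and super-words. For a standard word $u$, the super-letter $[u]$ is the polynomial obtained from the standard nonassociative word $[u]$ by interpreting brackets as the skew commutator, defined on polynomials homogeneous in each variable by $[f,h]=fh-p_{uv}hf$, where $u,v$ are any words having the constitutions of $f,h$. It is evaluated as an element of $H$. Super-letters are indexed by standard words and ordered by $[u]>[v]\iff u>v$. A super-word is a (formal) word in super-letters; a $G$-super-word is $gW$ with $g\in G$ and $W$ a super-word (possibly empty). The degree of a $G$-super-word $gW$ is the sum of the degrees of the super-letters of $W$, with $\deg[u]=\deg(u)$. A super-word is monotonic if it has the form $[u_1]^{n_1}\cdots[u_k]^{n_k}$ with $u_1<\cdots<u_k$. Hard super-letters and heights. A super-letter $[u]$ is hard if in $H$ it is not a linear combination of super-words of degree $\deg(u)$ in super-letters less than $[u]$ and of $G$-super-words of degree less than $\deg(u)$. The height of $[u]$ (of degree $d$) is the least natural number $h$ such that (1) $p_{uu}$ is a primitive $t$-th root of unity for some $t\ge1$, and either $h=t$ or $h=tl^k$ where $l>0$ is the characteristic of $\mathbf{k}$; and (2) $[u]^h$ is in $H$ a linear combination of super-words of degree $hd$ in super-letters less than $[u]$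 and of $G$-super-words of degree less than $hd$. If no such $h$ exists, the height is infinite. A monotonic $G$-super-word $g[u_1]^{n_1}\cdots[u_k]^{n_k}$ is restricted if each $n_i$ is less than the height of $[u_i]$. *)

(* Defs.v *)
From HB Require Import structures.
From mathcomp Require Import all_boot all_order all_algebra.
From mathcomp Require Import generic_quotient ring_quotient.
From mathcomp Require Import boolp classical_sets.
From mathcomp Require Import freeg.

Set Implicit Arguments.
Unset Strict Implicit.
Unset Printing Implicit Defensive.

Import Order.TTheory GRing.Theory.

Local Open Scope ring_scope.
Local Open Scope quotient_scope.

Reserved Notation "u \ox v" (at level 40, left associativity).

(* U \otimes V is the quotient of the free module on U * V by the submodule    *)
(* generated by the bilinearity relations.                                     *)
Section Tensor.
Variables (k : fieldType) (U V : lmodType k).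

Local Notation F := {freeg (U * V)%type / k}.

Inductive tensor_rel : F -> Prop :=
| TensorRel0 : tensor_rel 0
| TensorRelP c x y : tensor_rel x -> tensor_rel y -> tensor_rel (c *: x + y)
| TensorRelL c u u' v : tensor_rel
    (<< (c *: u + u', v) >> - (c *: << (u, v) >> + << (u', v) >>))
| TensorRelR c u v v' : tensor_rel
    (<< (u, c *: v + v') >> - (c *: << (u, v) >> + << (u, v') >>)).

Definition tensor_ker : pred F := fun x => `[< tensor_rel x >].

Lemma tensor_kerP x : reflect (tensor_rel x) (x \in tensor_ker).
Proof. exact: asboolP. Qed.

Lemma tensor_ker_zmod_closed : zmod_closed tensor_ker.
Proof.
split=> [|x y /tensor_kerP rx /tensor_kerP ry].
  by apply/tensor_kerP; exact: TensorRel0.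
by apply/tensor_kerP; rewrite addrC -scaleN1r; exact: TensorRelP.
Qed.

HB.instance Definition _ :=
  GRing.isZmodClosed.Build F tensor_ker tensor_ker_zmod_closed.

Definition tensor_kerZ := GRing.ZmodClosed.clone F tensor_ker _.

Definition tensor : Type := Quotient.quot tensor_kerZ.
HB.instance Definition _ := Choice.on tensor.
HB.instance Definition _ := EqQuotient.on tensor.
HB.instance Definition _ := GRing.Zmodule.on tensor.

Definition tensor_pi (x : F) : tensor := \pi_(Quotient.quot tensor_kerZ) x.

Lemma tensor_pi_eq x y : reflect (tensor_rel (x - y)) (tensor_pi x == tensor_pi y).
Proof. by rewrite /tensor_pi -Quotient.idealrBE; exact: tensor_kerP. Qed.

Lemma tensor_piD x y : tensor_pi (x + y) = tensor_pi x + tensor_pi y.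
Proof. by rewrite /tensor_pi !piE. Qed.

Definition tensor_repr (t : tensor) : F := repr (t : Quotient.quot tensor_kerZ).

Lemma tensor_reprK : cancel tensor_repr tensor_pi.
Proof. by move=> t; exact: reprK. Qed.

Definition tensor_scale (c : k) (t : tensor) : tensor :=
  tensor_pi (c *: tensor_repr t).

Lemma tensor_scale_pi c x : tensor_scale c (tensor_pi x) = tensor_pi (c *: x).
Proof.
apply/eqP/tensor_pi_eq; rewrite -scalerBr -[_ *: _]addr0.
apply: TensorRelP; last exact: TensorRel0.
by apply/tensor_pi_eq; rewrite tensor_reprK.
Qed.

Fact tensor_scaleA a b t :
  tensor_scale a (tensor_scale b t) = tensor_scale (a * b) t.
Proof. by rewrite -[t]tensor_reprK !tensor_scale_pi scalerA. Qed.
Fact tensor_scale1 : left_id 1 tensor_scale.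
Proof. by move=> t; rewrite -[t]tensor_reprK tensor_scale_pi scale1r. Qed.
Fact tensor_scaleDr : right_distributive tensor_scale +%R.
Proof.
move=> c t t'; rewrite -[t]tensor_reprK -[t']tensor_reprK.
by rewrite -tensor_piD !tensor_scale_pi scalerDr tensor_piD.
Qed.
Fact tensor_scaleDl t : {morph tensor_scale^~ t : a b / a + b}.
Proof.
move=> a b; rewrite -[t]tensor_reprK !tensor_scale_pi.
by rewrite scalerDl tensor_piD.
Qed.

HB.instance Definition _ := GRing.Zmodule_isLmodule.Build k tensor
  tensor_scaleA tensor_scale1 tensor_scaleDr tensor_scaleDl.

Definition tens (u : U) (v : V) : tensor := tensor_pi << (u, v) >>.
Local Notation "u \ox v" := (tens u v).

Lemma tensor_pi_linear : linear tensor_pi.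
Proof. by move=> c x y; rewrite tensor_piD -tensor_scale_pi. Qed.
HB.instance Definition _ :=
  GRing.isLinear.Build k F tensor *:%R tensor_pi tensor_pi_linear.

Lemma tens_linearl v : linear (tens^~ v).
Proof.
by move=> c u u'; rewrite /tens -linearP; apply/eqP/tensor_pi_eq; constructor.
Qed.
Lemma tens_linearr u : linear (tens u).
Proof.
by move=> c v v'; rewrite /tens -linearP; apply/eqP/tensor_pi_eq; constructor.
Qed.

Section Lift.
Variable W : lmodType k.

Definition bilinear_map (f : U -> V -> W) : Prop :=
  (forall v, linear (f^~ v)) /\ (forall u, linear (f u)).

Local Notation flift f := (fglift (fun p : U * V => f p.1 p.2 : W)).

(* Meaningful only for bilinear f: see tensor_lift_tens below.                 *)
Definition tensor_lift (f : U -> V -> W) (t : tensor) : W :=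
  flift f (tensor_repr t).

Variable f : U -> V -> W.

HB.instance Definition _ := GRing.isZmodMorphism.Build F W (flift f)
  (@lift_is_additive k _ W _).

Let fliftZ c x : flift f (c *: x) = c *: flift f x.
Proof.
rewrite -[x]freeg_sumE scaler_sumr 2!(raddf_sum (flift f)) /= scaler_sumr.
apply: eq_bigr => z _.
have -> : c *: << coeff z x *g z >> = << c * coeff z x *g z >>.
  apply/eqP/freeg_eqP => y; rewrite coeffZ !coeffU mulrA //.
by rewrite !liftU scalerA.
Qed.

Hypothesis fbil : bilinear_map f.

Let flift_rel x : tensor_rel x -> flift f x = 0.
Proof.
case: fbil => fl fr; elim=> [|c x0 y _ e _ e'|c u u' v|c u v v'].
- by rewrite raddf0.
- by rewrite raddfD /= fliftZ e e' scaler0 addr0.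
- by rewrite raddfB raddfD /= fliftZ !liftU !scale1r /= fl subrr.
- by rewrite raddfB raddfD /= fliftZ !liftU !scale1r /= fr subrr.
Qed.

Lemma tensor_lift_pi x : tensor_lift f (tensor_pi x) = flift f x.
Proof.
apply/eqP; rewrite -subr_eq0 -raddfB /=; apply/eqP; apply: flift_rel.
by apply/tensor_pi_eq; rewrite tensor_reprK.
Qed.

Lemma tensor_lift_linear : linear (tensor_lift f).
Proof.
move=> c t t'; rewrite -[t]tensor_reprK -[t']tensor_reprK -linearP.
by rewrite !tensor_lift_pi raddfD /= fliftZ.
Qed.

Lemma tensor_lift_tens u v : tensor_lift f (u \ox v) = f u v.
Proof. by rewrite tensor_lift_pi liftU scale1r. Qed.

End Lift.

Lemma tensor_spanned (t : tensor) :
  exists s : seq (U * V), t = \sum_(p <- s) p.1 \ox p.2.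
Proof.
set x := tensor_repr t; rewrite -[t]tensor_reprK -/x.
exists [seq (coeff z x *: z.1, z.2) | z <- dom x].
rewrite [RHS]big_map -{1}[x]freeg_sumE (raddf_sum tensor_pi).
apply: eq_bigr => -[u v] _ /=; set c := coeff _ _.
have -> : << c *g (u, v) >> = c *: << (u, v) >> :> F.
  by apply/eqP/freeg_eqP => y; rewrite coeffZ !coeffU mul1r.
have tens0 : 0 \ox v = 0.
  have /eqP := tens_linearl v 1 0 0; rewrite scaler0 addr0 scale1r.
  by rewrite -subr_eq subrr eq_sym => /eqP.
have := tens_linearl v c u 0; rewrite addr0 => ->.
by rewrite tens0 addr0 linearZ.
Qed.

Lemma tensor_lift_uniq (W : lmodType k) (F1 F2 : {linear tensor -> W}) :
  (forall u v, F1 (u \ox v) = F2 (u \ox v)) -> F1 =1 F2.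
Proof.
move=> e t; have [s ->] := tensor_spanned t.
by rewrite !raddf_sum; apply: eq_bigr => p _; exact: e.
Qed.

End Tensor.

Notation "u \ox v" := (tens u v) : ring_scope.

HB.instance Definition _ (k : fieldType) (U V : lmodType k) u :=
  GRing.isLinear.Build k V (tensor U V) *:%R (@tens k U V u)
    (@tens_linearr k U V u).

Definition tensor_map (k : fieldType) (U V U' V' : lmodType k)
    (f : U -> U') (g : V -> V') : tensor U V -> tensor U' V' :=
  tensor_lift (fun u v => f u \ox g v).

Definition tensor_assoc (k : fieldType) (U V W : lmodType k) :
    tensor (tensor U V) W -> tensor U (tensor V W) :=
  tensor_lift (fun t w => tensor_lift (fun u v => u \ox (v \ox w)) t).

Section TensorRing.
Variables (k : fieldType) (A B : algType k).
Local Notation T := (tensor A B).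
Implicit Types (x y z : T).

Definition tensor_one : T := 1 \ox 1.

Definition tensor_mul x y : T :=
  tensor_lift (fun a b => tensor_lift (fun a' b' => (a * a') \ox (b * b')) y) x.

Let mul1_bil a b :
  bilinear_map (fun (a' : A) (b' : B) => (a * a') \ox (b * b')).
Proof.
split=> [v c u u'|u c v v'].
  by rewrite mulrDr -scalerAr tens_linearl.
by rewrite mulrDr -scalerAr tens_linearr.
Qed.

Let mul1_lin a b :
  linear (tensor_lift (fun (a' : A) (b' : B) => (a * a') \ox (b * b'))).
Proof. exact: tensor_lift_linear. Qed.

HB.instance Definition _ a b := GRing.isLinear.Build k T T *:%R _ (mul1_lin a b).

Let mul2_bil y : bilinear_map (fun (a : A) (b : B) =>
  tensor_lift (fun a' b' => (a * a') \ox (b * b')) y).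
Proof.
have [s ->] := tensor_spanned y.
have E a b : tensor_lift (fun a' b' => (a * a') \ox (b * b'))
    (\sum_(p <- s) p.1 \ox p.2) = \sum_(p <- s) (a * p.1) \ox (b * p.2).
  rewrite (raddf_sum (tensor_lift (fun a' b' => (a * a') \ox (b * b')))).
  by apply: eq_bigr => p _; exact: (tensor_lift_tens (mul1_bil a b)).
split=> [v c u u'|u c v v']; rewrite !E scaler_sumr -big_split;
    apply: eq_bigr => p _ /=; rewrite mulrDl -scalerAl.
  by rewrite tens_linearl.
by rewrite tens_linearr.
Qed.

Definition tensor_mulr y x := tensor_mul x y.

Lemma tensor_mul_linearl y : linear (tensor_mulr y).
Proof. exact: tensor_lift_linear. Qed.
HB.instance Definition _ y :=
  GRing.isLinear.Build k T T *:%R (tensor_mulr y) (tensor_mul_linearl y).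

Lemma tensor_mul_suml I (s : seq I) (F : I -> T) y :
  tensor_mul (\sum_(i <- s) F i) y = \sum_(i <- s) tensor_mul (F i) y.
Proof. exact: (raddf_sum (tensor_mulr y)). Qed.

Lemma tensor_mul_linearr x : linear (tensor_mul x).
Proof.
have [s ->] := tensor_spanned x.
have E y : tensor_mul (\sum_(p <- s) p.1 \ox p.2) y = \sum_(p <- s)
    tensor_lift (fun a' b' => (p.1 * a') \ox (p.2 * b')) y.
  rewrite tensor_mul_suml; apply: eq_bigr => p _.
  by rewrite /tensor_mul tensor_lift_tens.
move=> c y y'; rewrite !E scaler_sumr -big_split.
by apply: eq_bigr => p _; rewrite mul1_lin.
Qed.
HB.instance Definition _ x :=
  GRing.isLinear.Build k T T *:%R (tensor_mul x) (tensor_mul_linearr x).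

Lemma tensor_mul_sumr I (s : seq I) (F : I -> T) x :
  tensor_mul x (\sum_(i <- s) F i) = \sum_(i <- s) tensor_mul x (F i).
Proof. exact: (raddf_sum (tensor_mul x)). Qed.

Lemma tensor_mulE a b a' b' :
  tensor_mul (a \ox b) (a' \ox b') = (a * a') \ox (b * b').
Proof. by rewrite /tensor_mul !tensor_lift_tens. Qed.

Fact tensor_mulA : associative tensor_mul.
Proof.
move=> x y z; have [sx ->] := tensor_spanned x; have [sy ->] := tensor_spanned y.
have [sz ->] := tensor_spanned z.
have E s s' : tensor_mul (\sum_(p <- s) p.1 \ox p.2) (\sum_(p <- s') p.1 \ox p.2)
    = \sum_(p <- s) \sum_(q <- s') (p.1 * q.1) \ox (p.2 * q.2).
  rewrite tensor_mul_suml; apply: eq_bigr => p _.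
  by rewrite tensor_mul_sumr; apply: eq_bigr => q _; exact: tensor_mulE.
rewrite !E !tensor_mul_suml /=.
apply: eq_bigr => p _; rewrite tensor_mul_suml tensor_mul_sumr /=.
apply: eq_bigr => q _; rewrite !tensor_mul_sumr; apply: eq_bigr => r _ /=.
by rewrite !tensor_mulE !mulrA.
Qed.
Fact tensor_mul1 : left_id tensor_one tensor_mul.
Proof.
move=> x; have [s ->] := tensor_spanned x; rewrite tensor_mul_sumr.
by apply: eq_bigr => p _; rewrite tensor_mulE !mul1r.
Qed.
Fact tensor_mulr1 : right_id tensor_one tensor_mul.
Proof.
move=> x; have [s ->] := tensor_spanned x; rewrite tensor_mul_suml.
by apply: eq_bigr => p _; rewrite tensor_mulE !mulr1.
Qed.
Fact tensor_mulDl : left_distributive tensor_mul +%R.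
Proof. by move=> x y z; exact: (raddfD (tensor_mulr z)). Qed.
Fact tensor_mulDr : right_distributive tensor_mul +%R.
Proof. by move=> x y z; exact: (raddfD (tensor_mul x)). Qed.

HB.instance Definition _ := GRing.Zmodule_isPzRing.Build T
  tensor_mulA tensor_mul1 tensor_mulr1 tensor_mulDl tensor_mulDr.

End TensorRing.

HB.mixin Record Algebra_isHopf (k : fieldType) H of GRing.Algebra k H := {
  comul : H -> tensor H H;
  counit : H -> k;
  antipode : H -> H;
  comul_linear : linear comul;
  comul_monoid : monoid_morphism comul;
  counit_linear : scalar counit;
  counit_monoid : monoid_morphism counit;
  antipode_linear : linear antipode;
  comulA : forall h,
    tensor_assoc (tensor_map comul id (comul h)) = tensor_map id comul (comul h);
  counitl : forall h, tensor_lift (fun x y => counit x *: y) (comul h) = h;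
  counitr : forall h, tensor_lift (fun x y => counit y *: x) (comul h) = h;
  antipodel : forall h,
    tensor_lift (fun x y => antipode x * y) (comul h) = (counit h)%:A;
  antipoder : forall h,
    tensor_lift (fun x y => x * antipode y) (comul h) = (counit h)%:A
}.

#[short(type="hopfAlgType")]
HB.structure Definition HopfAlgebra (k : fieldType) :=
  {H of Algebra_isHopf k H & GRing.Algebra k H}.

HB.instance Definition _ (k : fieldType) (H : hopfAlgType k) :=
  GRing.isLinear.Build k H (tensor H H) *:%R (@comul k H) comul_linear.
HB.instance Definition _ (k : fieldType) (H : hopfAlgType k) :=
  GRing.isMonoidMorphism.Build H (tensor H H) (@comul k H) comul_monoid.
HB.instance Definition _ (k : fieldType) (H : hopfAlgType k) :=
  GRing.isLinear.Build k H k *%R (@counit k H) counit_linear.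
HB.instance Definition _ (k : fieldType) (H : hopfAlgType k) :=
  GRing.isMonoidMorphism.Build H k (@counit k H) counit_monoid.
HB.instance Definition _ (k : fieldType) (H : hopfAlgType k) :=
  GRing.isLinear.Build k H H *:%R (@antipode k H) antipode_linear.

Section HopfNotions.
Variables (k : fieldType) (H : hopfAlgType k).

Definition grouplike (g : H) : Prop := comul g = g \ox g /\ counit g = 1.

(* Only the values of chi on group-like elements matter.                       *)
Definition is_character (chi : H -> k) : Prop :=
  (forall g, grouplike g -> chi g != 0) /\
  (forall g h, grouplike g -> grouplike h -> chi (g * h) = chi g * chi h).

Definition skew_primitive_semi_invariant (a g : H) (chi : H -> k) : Prop :=
  [/\ grouplike g, is_character chi, comul a = a \ox 1 + g \ox a &
      forall h, grouplike h -> a * h = chi h *: (h * a)].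

End HopfNotions.

Section LinearCombinations.
Variables (k : fieldType) (V : lmodType k).

Definition lin_comb (S : V -> Prop) (v : V) : Prop :=
  exists2 s : seq (k * V), (forall p, p \in s -> S p.2) &
    v = \sum_(p <- s) p.1 *: p.2.

(* The family (f i), i ranging over the indices satisfying P, is a basis; in   *)
(* particular it has no repetitions.                                           *)
Definition is_basis (I : choiceType) (P : I -> Prop) (f : I -> V) : Prop :=
  (forall (s : seq I) (c : I -> k), uniq s -> (forall i, i \in s -> P i) ->
     \sum_(i <- s) c i *: f i = 0 -> forall i, i \in s -> c i = 0) /\
  (forall v, exists (s : seq I) (c : I -> k),
     (forall i, i \in s -> P i) /\ v = \sum_(i <- s) c i *: f i).

End LinearCombinations.

Definition generates_algebra (k : fieldType) (A : algType k) (X : A -> Prop) :=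
  forall S : {pred A}, GRing.subalg_closed S -> (forall x, X x -> x \in S) ->
  forall x, x \in S.

Section Words.
Variable n : nat.
Implicit Types u v w : seq 'I_n.

(* The letter of index i is greater than the letter of index j when i < j, and *)
(* a proper prefix of a word is greater than the word: this is the dual of the *)
(* usual lexicographic order on sequences of indices.                          *)
Definition word_lt u v : bool := ((v : seqlexi 'I_n) < u)%O.
Definition word_le u v : bool := ((v : seqlexi 'I_n) <= u)%O.

Definition standard u : Prop :=
  u <> [::] /\ forall u1 u2, u1 <> [::] -> u2 <> [::] -> u = u1 ++ u2 ->
    word_lt (u2 ++ u1) u.

Inductive nword := NLetter of 'I_n | NPair of nword & nword.

Fixpoint erase (t : nword) : seq 'I_n :=
  match t with
  | NLetter i => [:: i]
  | NPair l r => erase l ++ erase r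
  end.

Fixpoint standard_nword (t : nword) : Prop :=
  standard (erase t) /\
  match t with
  | NLetter _ => True
  | NPair v w => [/\ standard_nword v, standard_nword w &
      if v is NPair v1 v2 then word_le (erase v2) (erase w) : Prop else True]
  end.

Definition wdeg (d : 'I_n -> nat) u : nat := (\sum_(i <- u) d i)%N.

End Words.

Section SuperWords.
Variables (k : fieldType) (H : hopfAlgType k) (n : nat).
Variables (a g : 'I_n -> H) (chi : 'I_n -> H -> k) (d : 'I_n -> nat).

Local Notation word := (seq 'I_n).
Implicit Types (u v : word) (W : seq word).

Definition word_grouplike u : H := \prod_(i <- u) g i.
Definition word_char u (h : H) : k := \prod_(i <- u) chi i h.
Definition p_ u v : k := word_char u (word_grouplike v).

Fixpoint nword_val (t : nword n) : H :=
  match t with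
  | NLetter i => a i
  | NPair l r => nword_val l * nword_val r
                 - p_ (erase l) (erase r) *: (nword_val r * nword_val l)
  end.

(* A standard word has exactly one standard bracketing (Shirshov); the default *)
(* value 0 is for the words that are not standard.                             *)
Definition super_letter u : H :=
  xget 0 [set h | exists2 t, standard_nword t /\ erase t = u & h = nword_val t].

(* A super-word is represented by the sequence of standard words indexing its  *)
(* super-letters.                                                              *)
Definition is_super_word W : Prop := forall u, u \in W -> standard u.
Definition sw_deg W : nat := (\sum_(u <- W) wdeg d u)%N.
Definition sw_val W : H := \prod_(u <- W) super_letter u.

Definition lower_terms u (m : nat) (x : H) : Prop :=
  (exists W, [/\ is_super_word W, sw_deg W = m,
                 forall v, v \in W -> word_lt v u & x = sw_val W]) \/
  (exists h W, [/\ grouplike h, is_super_word W, (sw_deg W < m)%N &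
                   x = h * sw_val W]).

Definition hard u : Prop :=
  standard u /\ ~ lin_comb (lower_terms u (wdeg d u)) (super_letter u).

Definition height_cond u (h : nat) : Prop :=
  (exists t : nat, t.-primitive_root (p_ u u) /\
     (h = t \/ exists (l e : nat), l \in [pchar k] /\ h = (t * l ^ e)%N)) /\
  lin_comb (lower_terms u (h * wdeg d u)) (super_letter u ^+ h).

(* None stands for an infinite height.                                         *)
Definition height u : option nat :=
  match pselect (exists h, `[< height_cond u h >]) with
  | left exh => Some (ex_minn exh)
  | right _ => None
  end.

Definition lt_height u (m : nat) : Prop :=
  if height u is Some h then (m < h)%N : Prop else True.

(* (h, [:: (u_1, n_1); ...; (u_r, n_r)]) stands for the G-super-word           *)
(* h [u_1]^n_1 ... [u_r]^n_r.                                                  *)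
Definition monotonic_restricted_hard (x : H * seq (word * nat)) : Prop :=
  [/\ grouplike x.1, sorted (@word_lt n) [seq q.1 | q <- x.2] &
      forall q, q \in x.2 -> [/\ hard q.1, (0 < q.2)%N & lt_height q.1 q.2]].

Definition monotonic_val (x : H * seq (word * nat)) : H :=
  x.1 * \prod_(q <- x.2) super_letter q.1 ^+ q.2.

End SuperWords.

(* Main.v *)
Require Import Defs.
From mathcomp Require Import all_boot all_order all_algebra zify ring.
From mathcomp Require Import boolp classical_sets.

(* Spanning: for standard words u > v the skew commutator of [u] and [v] is a      *)
(* combination of super-words in super-letters at most [uv] < [u]. So the greatest *)
(* letter u of a super-word can be moved to the right, modulo super-words in       *)
(* smaller letters; powers of [u] that are not allowed in the basis are replaced   *)
(* by means of the definitions of hardness and height.                             *)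
(*                                                                                 *)
(* Independence: the coproduct of [u] is [u] (x) 1 + g_u (x) [u] plus terms whose  *)
(* left factors are non-empty super-words in letters less than [u]. In a relation  *)
(* of degree m with greatest letter u, taking the coefficient of h [u]^s on the    *)
(* left of the coproduct turns g W [u]^n into a Gauss binomial coefficient of      *)
(* (n, s) at p_uu times g W [u]^(n-s), up to lower degree. By induction on m these *)
(* coefficients vanish, so that u occurs at most in terms g [u]^N of degree m, and *)
(* N is the order of p_uu, possibly times a power of the characteristic (if        *)
(* N > 1). The relation then makes [u] not hard, or the height of [u] at most N.   *)

Set Implicit Arguments.
Unset Strict Implicit.
Unset Printing Implicit Defensive.

Import Order.TTheory GRing.Theory.
Local Open Scope ring_scope.

(** * Linear combinations and tensor products *)

(** Filter [H] by degree, so that G-super-words of smaller degree can be neglected. Spanning rests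
    on [skew_super_letter]: for u > v the bracket of [u] and [v] involves only super-letters at most
    [uv], and these are less than [u]. Hence the greatest letter of a super-word can be collected on
    the right ([move_letter]), and a power of it that is not admissible is rewritten by the
    definitions of hardness and height ([reduce_power]). The process stops because only finitely
    many words fit into a given degree ([reducible_all]).

    Independence uses the coproduct as a derivative. By [comul_super_letter] the main part of the
    coproduct of [u] is [u] (x) 1 + g_u (x) [u]. Its two summands q-commute with q = p_uu, so the
    coproduct of g W [u]^n is governed by Gauss binomial coefficients ([comul_leading]). Suppose
    that independence holds in degrees below m, and take a relation of degree m whose greatest
    letter in degree m is u. A functional dual to h [u]^s, applied to the left tensor factors,
    lowers the degree by s deg(u) and multiplies a coefficient by the Gauss binomial of (n, s). So
    this binomial vanishes whenever 0 < s <= n and s deg(u) < m ([relation_gauss_binomial]).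

    For s = n the binomial is 1, so a top term that contains u is g [u]^N with N deg(u) = m. For 0 <
    s < N the vanishing forces N to be the order of p_uu, possibly times a power of the
    characteristic, if N > 1 ([gauss_binomial_vanish]): these are the exponents allowed as heights.
    Once the other group-like prefixes are removed ([relation_prefix]), the relation expresses [u]^N
    by lower terms. This contradicts hardness if N = 1, and the bound by the height if N > 1
    ([relation_top]). *)

Definition subspace (k : fieldType) (V : lmodType k) (T : V -> Prop) :=
  T 0 /\ forall c x y, T x -> T y -> T (c *: x + y).

Lemma linear_at0 (k : fieldType) (V W : lmodType k) (f : V -> W) :
  linear f -> f 0 = 0.
Proof.
move=> lf; have /eqP := lf 1 0 0; rewrite !scale1r addr0 -subr_eq subrr.
by rewrite eq_sym => /eqP.
Qed.

Lemma linear_atB (k : fieldType) (V W : lmodType k) (f : V -> W) x y :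
  linear f -> f (x - y) = f x - f y.
Proof. by move=> lf; rewrite -scaleN1r addrC lf scaleN1r addrC. Qed.

Lemma linear_sumZ (k : fieldType) (V W : lmodType k) (f : V -> W) (I : Type)
    (s : seq I) (c : I -> k) (F : I -> V) :
  linear f -> f (\sum_(i <- s) c i *: F i) = \sum_(i <- s) c i *: f (F i).
Proof.
move=> lf; elim: s => [|i s IH]; first by rewrite !big_nil (linear_at0 lf).
by rewrite !big_cons lf IH.
Qed.

Section LinComb.
Variables (k : fieldType) (V : lmodType k).
Implicit Types (S T : V -> Prop) (x y v : V).

Lemma subspaceD T x y : subspace T -> T x -> T y -> T (x + y).
Proof. by case=> _ h Tx Ty; rewrite -[x]scale1r; apply: h. Qed.

Lemma subspaceZ T c x : subspace T -> T x -> T (c *: x).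
Proof. by case=> h0 h Tx; rewrite -[_ *: _]addr0; apply: h. Qed.

Lemma subspaceN T x : subspace T -> T x -> T (- x).
Proof. by rewrite -scaleN1r; apply: subspaceZ. Qed.

Lemma subspaceB T x y : subspace T -> T x -> T y -> T (x - y).
Proof. by move=> sT Tx Ty; apply: subspaceD => //; apply: subspaceN. Qed.

Lemma subspaceDr T x y : subspace T -> T x -> T (x + y) -> T y.
Proof. by move=> sT Tx /(subspaceB sT) /(_ Tx); rewrite addrC addKr. Qed.

Lemma subspaceDl T x y : subspace T -> T y -> T (x + y) -> T x.
Proof. by rewrite addrC; apply: subspaceDr. Qed.

Lemma subspace_unscale T c x : subspace T -> c != 0 -> T (c *: x) -> T x.
Proof.
by move=> sT c0 /(subspaceZ c^-1 sT); rewrite scalerA mulVf // scale1r.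
Qed.

Lemma subspace_sum T (I : Type) (r : seq I) (P : pred I) (F : I -> V) :
  subspace T -> (forall i, P i -> T (F i)) -> T (\sum_(i <- r | P i) F i).
Proof.
move=> sT h; elim/big_ind: _ => //; first by case: sT.
by move=> x y; apply: subspaceD.
Qed.

Lemma subspace_sum_seq T (I : eqType) (r : seq I) (F : I -> V) :
  subspace T -> (forall i, i \in r -> T (F i)) -> T (\sum_(i <- r) F i).
Proof. by move=> sT h; rewrite big_seq; apply: subspace_sum. Qed.

Lemma subspace_preim (W : lmodType k) (f : V -> W) (U : W -> Prop) :
  linear f -> subspace U -> subspace (fun x => U (f x)).
Proof.
move=> lf [U0 UP]; split=> [|c x y Ux Uy]; last by rewrite lf; apply: UP.
by rewrite (linear_at0 lf).
Qed.

Lemma lin_comb_subspace S : subspace (lin_comb S).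
Proof.
split=> [|c x y [s sS ->] [s' sS' ->]]; first by exists [::]; rewrite ?big_nil.
exists ([seq (c * p.1, p.2) | p <- s] ++ s') => [p|].
  by rewrite mem_cat => /orP[/mapP[q /sS qS ->] //|/sS'].
rewrite big_cat big_map scaler_sumr; congr (_ + _).
by apply: eq_bigr => p _; rewrite scalerA.
Qed.

Lemma lin_comb_incl S x : S x -> lin_comb S x.
Proof.
move=> Sx; exists [:: (1, x)] => [p|]; first by rewrite inE => /eqP ->.
by rewrite big_seq1 scale1r.
Qed.

Lemma lin_comb_ind S T v :
  subspace T -> (forall x, S x -> T x) -> lin_comb S v -> T v.
Proof.
move=> sT ST [s sS ->]; rewrite big_seq; apply: subspace_sum => // p /sS /ST.
exact: subspaceZ.
Qed.

Lemma lin_comb_sub S T v :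
  (forall x, S x -> T x) -> lin_comb S v -> lin_comb T v.
Proof.
move=> ST; apply: lin_comb_ind; first exact: lin_comb_subspace.
by move=> x /ST; apply: lin_comb_incl.
Qed.

Lemma lin_comb0 S : lin_comb S 0. Proof. by case: (lin_comb_subspace S). Qed.

Lemma lin_combD S x y : lin_comb S x -> lin_comb S y -> lin_comb S (x + y).
Proof. exact: subspaceD (lin_comb_subspace S). Qed.

Lemma lin_combB S x y : lin_comb S x -> lin_comb S y -> lin_comb S (x - y).
Proof. exact: subspaceB (lin_comb_subspace S). Qed.

Lemma lin_combZ S c x : lin_comb S x -> lin_comb S (c *: x).
Proof. exact: subspaceZ (lin_comb_subspace S). Qed.

(** [lin_comb] allows repeated vectors; coefficients of equal indices are added here, so that a
    relation becomes a coefficient function on distinct indices. *)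
Lemma lin_comb_indexed (I : choiceType) (P : I -> Prop) (f : I -> V) v :
  lin_comb (fun x => exists2 i, P i & x = f i) v ->
  exists (s : seq I) (c : I -> k), [/\ uniq s, forall i, i \in s -> P i &
    v = \sum_(i <- s) c i *: f i].
Proof.
apply: (lin_comb_ind (T := fun v => exists s c, [/\ uniq s,
  forall i, i \in s -> P i & v = \sum_(i <- s) c i *: f i])) => [|_ [i Pi ->]];
  last first.
  exists [:: i], (fun=> 1); split=> // [j|]; first by rewrite inE => /eqP ->.
  by rewrite big_seq1 scale1r.
split=> [|a x y [s [c [us sP ->]]] [t [e [ut tP ->]]]].
  by exists [::], (fun=> 0); rewrite big_nil.
exists (undup (s ++ t)), (fun i => a * (if i \in s then c i else 0)
  + (if i \in t then e i else 0)); split=> [|i|]; first exact: undup_uniq.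
  by rewrite mem_undup mem_cat => /orP[/sP|/tP].
under [RHS]eq_bigr => i _ do rewrite scalerDl -scalerA.
rewrite big_split -scaler_sumr /=.
have sub r b : uniq r -> {subset r <= s ++ t} -> \sum_(i <- undup (s ++ t))
    (if i \in r then b i else 0) *: f i = \sum_(i <- r) b i *: f i.
  move=> ur rst; under eq_bigr => i _.
    rewrite (_ : _ *: _ = if i \in r then b i *: f i else 0); last first.
      by case: ifP; rewrite ?scale0r.
    over.
  rewrite -big_mkcond /= -big_filter; apply: perm_big; apply: uniq_perm => //.
    exact/filter_uniq/undup_uniq.
  move=> i; rewrite mem_filter mem_undup.
  by apply/andP/idP => [[]//|ir]; split=> //; apply: rst.
by rewrite !sub // => i; rewrite mem_cat => ->; rewrite ?orbT.
Qed.

Lemma lin_comb_seq (s : seq V) v :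
  lin_comb (fun w : V => w \in s) v -> uniq s ->
  exists e : V -> k, v = \sum_(i <- s) e i *: i.
Proof.
move=> hv us; apply: (lin_comb_ind (T := fun v : V => exists e : V -> k,
  v = \sum_(i <- s) e i *: i)) hv => [|w ws].
  split=> [|c v1 v2 [e ->] [f ->]].
    by exists (fun=> 0); rewrite big1 // => i _; rewrite scale0r.
  exists (fun i => c * e i + f i); rewrite scaler_sumr -big_split.
  by apply: eq_bigr => i _; rewrite scalerDl scalerA.
exists (fun i => (i == w)%:R); rewrite (bigD1_seq w) //= eqxx scale1r big1 ?addr0 //.
by move=> i /negbTE ->; rewrite scale0r.
Qed.

(* By Zorn, a maximal subspace containing T but not x is a hyperplane *)
(* complementary to the line of x, whose coordinate is the functional. *)
Lemma separating_functional T x : subspace T -> ~ T x ->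
  exists phi : V -> k, [/\ scalar phi, phi x = 1 & forall y, T y -> phi y = 0].
Proof.
move=> sT nTx.
pose Q (A : set V) := [/\ subspace A, ~ A x & forall y, T y -> A y].
pose R := fun A : set V => Q A \/ A = set0.
have [|M [RM Mmax]] := @Zorn_bigcup V R.
  move=> F FR Ftot.
  have [[A0 FA0 QA0]|nF] := pselect (exists2 A, F A & Q A); last first.
    right; apply/seteqP; split=> // y [A FA Ay]; exfalso.
    by case: (FR _ FA) => [QA|A0]; [case: nF; exists A|rewrite A0 in Ay].
  left; split=> [|[A FA Ax]|y Ty].
  - split=> [|c y z [A FA Ay] [B FB Bz]].
      by exists A0 => //; case: QA0 => -[].
    have lin C : F C -> C y -> C z -> (\bigcup_(X in F) X)%classic (c *: y + z).
      move=> FC Cy Cz; exists C => //; case: (FR _ FC) => [[[_ h] _ _]|C0].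
        exact: h.
      by rewrite C0 in Cy.
    case: (Ftot _ _ FA FB) => [AB|BA]; first by apply: (lin B) => //; apply: AB.
    by apply: (lin A) => //; apply: BA.
  - by case: (FR _ FA) => [[]//|E0]; rewrite E0 in Ax.
  - by exists A0 => //; case: QA0 => _ _; apply.
have [sM nMx TM] : Q M.
  case: RM => // M0; case: (Mmax T); last by left; split.
  by rewrite M0; split=> // /(_ 0); apply; case: sT.
have dec y : exists c, M (y - c *: x).
  have [My|nMy] := pselect (M y); first by exists 0; rewrite scale0r subr0.
  pose N := (fun z => exists c, M (z - c *: y)) : set V.
  have sN : subspace N.
    split=> [|c z t [e Mz] [e' Mt]].
      by exists 0; rewrite scale0r subr0; case: sM.
    exists (c * e + e'); rewrite scalerDl opprD addrACA -scalerA -scalerBr.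
    by case: sM => _; apply.
  have MN : (M `<` N)%classic.
    split=> [z Mz|/(_ y) NM]; first by exists 0; rewrite scale0r subr0.
    by apply/nMy/NM; exists 1; rewrite scale1r subrr; case: sM.
  have [Nx|nNx] := pselect (N x); last first.
    by case: (Mmax _ MN); left; split=> // z /TM; apply: (proj1 MN).
  case: Nx => c Mc; have [c0|c0] := eqVneq c 0.
    by case: nMx; rewrite c0 scale0r subr0 in Mc.
  exists c^-1; apply: (subspace_unscale (c := - c) sM); first by rewrite oppr_eq0.
  by rewrite scalerBr scaleNr scalerA mulNr mulfV // scaleN1r opprK addrC.
pose phi y := projT1 (cid (dec y)).
have phiP y c : M (y - c *: x) -> phi y = c.
  rewrite /phi; case: cid => e /= Me Mc; apply/eqP; rewrite -subr_eq0.
  apply/negPn/negP => ec; apply/nMx/(subspace_unscale sM ec).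
  have := subspaceB sM Mc Me.
  by rewrite opprB addrC addrA subrK -scalerBl.
have phiM y : M (y - phi y *: x) by rewrite /phi; case: cid.
exists phi; split=> [c y z||y /TM My]; apply: phiP.
- rewrite scalerDl opprD addrACA -scalerA -scalerBr.
  by case: sM => _; apply.
- by rewrite scale1r subrr; case: sM.
- by rewrite scale0r subr0.
Qed.

End LinComb.

Lemma lin_comb_map (k : fieldType) (V W : lmodType k) (S : V -> Prop)
    (T : W -> Prop) (f : V -> W) v : linear f ->
  (forall x, S x -> lin_comb T (f x)) -> lin_comb S v -> lin_comb T (f v).
Proof.
move=> lf h; apply: (lin_comb_ind (T := fun v => lin_comb T (f v))) => //.
exact/subspace_preim/lin_comb_subspace.
Qed.

Lemma lin_comb_mul (k : fieldType) (A : algType k) (S S' T : A -> Prop) x y :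
  (forall x y, S x -> S' y -> lin_comb T (x * y)) ->
  lin_comb S x -> lin_comb S' y -> lin_comb T (x * y).
Proof.
move=> h hx hy; move: hx; apply: (lin_comb_map (f := fun x => x * y)) => [c u v|u Su].
  by rewrite mulrDl scalerAl.
move: hy; apply: lin_comb_map => [c v w|v Sv]; last exact: h.
by rewrite mulrDr scalerAr.
Qed.

Section Tensor.
Variables (k : fieldType) (A B : algType k).
Implicit Types (x y : tensor A B).

Lemma tensM (a a' : A) (b b' : B) :
  (a \ox b) * (a' \ox b') = (a * a') \ox (b * b').
Proof. exact: tensor_mulE. Qed.

Lemma tens_scalerAl c x y : c *: (x * y) = (c *: x) * y.
Proof. exact/esym/(linearZ_LR (tensor_mulr y)). Qed.

Lemma tens_scalerAr c x y : c *: (x * y) = x * (c *: y).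
Proof. exact/esym/(linearZ_LR (tensor_mul x)). Qed.

Lemma lin_comb_tensor_mul (S S' T : tensor A B -> Prop) x y :
  (forall x y, S x -> S' y -> lin_comb T (x * y)) ->
  lin_comb S x -> lin_comb S' y -> lin_comb T (x * y).
Proof.
move=> h hx hy; move: hx; apply: (lin_comb_map (f := fun x => x * y)) => [c u v|u Su].
  by rewrite mulrDl tens_scalerAl.
move: hy; apply: lin_comb_map => [c v w|v Sv]; last exact: h.
by rewrite mulrDr tens_scalerAr.
Qed.

Lemma tensZl c (a : A) (b : B) : (c *: a) \ox b = c *: (a \ox b).
Proof.
have tens0 := linear_at0 (@tens_linearl _ A B b).
by have := tens_linearl b c a 0; rewrite addr0 tens0 addr0.
Qed.

Lemma tensBl (a a' : A) (b : B) : (a - a') \ox b = a \ox b - a' \ox b.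
Proof.
by rewrite -[- a']scaleN1r addrC tens_linearl scaleN1r addrC.
Qed.

Lemma tensZr c (a : A) (b : B) : a \ox (c *: b) = c *: (a \ox b).
Proof. exact: linearZ. Qed.

(** This is phi (x) id, and [tensor_evalr] is id (x) phi. Composed with [comul] they turn one
    relation in [H] into another. *)
Definition tensor_evall (phi : A -> k) : tensor A B -> B :=
  tensor_lift (fun a b => phi a *: b).
Definition tensor_evalr (phi : B -> k) : tensor A B -> A :=
  tensor_lift (fun a b => phi b *: a).

Lemma bilinear_evall (phi : A -> k) : scalar phi ->
  bilinear_map (fun (a : A) (b : B) => phi a *: b).
Proof.
move=> lphi; split=> [v c u u'|u c v v']; first by rewrite lphi scalerDl scalerA.
by rewrite scalerDr scalerA mulrC -scalerA.
Qed.

Lemma bilinear_evalr (phi : B -> k) : scalar phi ->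
  bilinear_map (fun (a : A) (b : B) => phi b *: a).
Proof.
move=> lphi; split=> [v c u u'|u c v v']; last by rewrite lphi scalerDl scalerA.
by rewrite scalerDr scalerA mulrC -scalerA.
Qed.

Lemma tensor_evall_linear phi : scalar phi -> linear (tensor_evall phi).
Proof. by move=> /bilinear_evall; apply: tensor_lift_linear. Qed.

Lemma tensor_evalr_linear phi : scalar phi -> linear (tensor_evalr phi).
Proof. by move=> /bilinear_evalr; apply: tensor_lift_linear. Qed.

Lemma tensor_evallE phi a b : scalar phi -> tensor_evall phi (a \ox b) = phi a *: b.
Proof. by move=> h; rewrite /tensor_evall (tensor_lift_tens (bilinear_evall h)). Qed.

Lemma tensor_evalrE phi a b : scalar phi -> tensor_evalr phi (a \ox b) = phi b *: a.
Proof. by move=> h; rewrite /tensor_evalr (tensor_lift_tens (bilinear_evalr h)). Qed.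

End Tensor.

Lemma size_mem_flatten (T : eqType) (r : seq (seq T)) (s : seq T) :
  s \in r -> (size s <= size (flatten r))%N.
Proof.
elim: r => //= t r IH; rewrite inE size_cat => /orP[/eqP ->|/IH]; lia.
Qed.

Lemma count_lt (T : eqType) (P Q : pred T) (s : seq T) (x : T) :
  subpred P Q -> x \in s -> Q x -> ~~ P x -> (count P s < count Q s)%N.
Proof.
move=> PQ; elim: s => //= y s IH; rewrite inE => /orP[/eqP <-|/IH h] Qx nPx.
  by rewrite Qx (negbTE nPx) add1n ltnS; apply: sub_count.
by rewrite -addnS leq_add ?h //; case: (P y) (PQ y) => // ->.
Qed.

(** * Standard words *)

Section WordOrder.
Local Open Scope nat_scope.
Variable n : nat.
Implicit Types u v w x y z : seq 'I_n.

Lemma word_ltxx u : word_lt u u = false.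
Proof. exact: ltxx. Qed.

Lemma word_lt_trans v u w : word_lt u v -> word_lt v w -> word_lt u w.
Proof. by move=> h1 h2; apply: lt_trans h2 h1. Qed.

Lemma word_le_eqVlt u v : word_le u v = (u == v) || word_lt u v.
Proof. by rewrite /word_le le_eqVlt eq_sym. Qed.

Lemma word_leNgt u v : word_le u v = ~~ word_lt v u.
Proof. exact: leNgt. Qed.

Lemma word_lt_le_trans v u w : word_lt u v -> word_le v w -> word_lt u w.
Proof. by move=> h1 h2; apply: le_lt_trans h2 h1. Qed.

Lemma word_le_lt_trans v u w : word_le u v -> word_lt v w -> word_lt u w.
Proof. by move=> h1 h2; apply: lt_le_trans h2 h1. Qed.

Lemma word_le_trans v u w : word_le u v -> word_le v w -> word_le u w.
Proof. by move=> h1 h2; apply: le_trans h2 h1. Qed.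

Lemma word_ltW u v : word_lt u v -> word_le u v.
Proof. exact: ltW. Qed.

Lemma word_lt_cons (i j : 'I_n) u v :
  word_lt (i :: u) (j :: v) = (j < i)%N || (i == j) && word_lt u v.
Proof.
rewrite /word_lt [LHS]preorder.Order.SeqLexiOrder.ltxi_cons.
rewrite !leEord /word_lt; case: (ltngtP i j) => //= h.
  by case: (i =P j) h => [->|//]; rewrite ltnn.
by rewrite (val_inj h) eqxx.
Qed.

Lemma word_lt_nilr u : word_lt u [::] = (u != [::]).
Proof. by case: u. Qed.

Lemma word_lt_cat2l w u v : word_lt (w ++ u) (w ++ v) = word_lt u v.
Proof. by elim: w => //= i w IH; rewrite word_lt_cons eqxx IH ltnn. Qed.

Lemma word_le_cat2l w u v : word_le (w ++ u) (w ++ v) = word_le u v.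
Proof. by rewrite !word_leNgt word_lt_cat2l. Qed.

Lemma word_lt_catr u v : v != [::] -> word_lt (u ++ v) u.
Proof. by rewrite -{2}[u]cats0 word_lt_cat2l word_lt_nilr. Qed.

(** Unless [v] is a prefix of [u], the comparison is decided at a distinct letter and survives any
    continuation of both words. *)
Lemma word_lt_cat u v x y :
  word_lt u v -> ~~ prefix v u -> word_lt (u ++ x) (v ++ y).
Proof.
elim: u v => [|i u IH] [|j v] //=.
rewrite !word_lt_cons => /orP[-> //|/andP[/eqP <- uv]].
by rewrite eqxx /= => h; apply/orP; right; apply: IH.
Qed.

Lemma word_lt_prefix_size u v : word_lt u v -> size u <= size v ->
  ~~ prefix v u.
Proof.
move=> uv suv; apply/negP => /prefixP[x xE]; move: suv; rewrite xE size_cat.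
by case: x xE uv => [->|]; rewrite ?cats0 ?word_ltxx //=; lia.
Qed.

(** Suppose y >= u. If y is not a prefix of u, then yx > u, against standardness. If u = yt, then yx
    < yt gives x < t with x and t of equal length, hence xy < ty, while standardness gives ty < u =
    xy. *)
Lemma standard_suffix u x y : standard u -> u = x ++ y ->
  x <> [::] -> y <> [::] -> word_lt y u.
Proof.
move=> [_ su] uE x0 y0.
have yxu := su _ _ x0 y0 uE.
rewrite -[word_lt y u]negbK -word_leNgt word_le_eqVlt; apply/negP.
case/orP => [/eqP uy|uy].
  by move: (congr1 size uE); rewrite uy size_cat; case: (x) x0 => //= *; lia.
have [/prefixP[t tE]|npre] := boolP (prefix y u); last first.
  have := word_lt_cat [::] x uy npre; rewrite cats0 => uyx.
  by have := word_lt_trans yxu uyx; rewrite word_ltxx.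
have st : size t = size x.
  by have /eqP := congr1 size tE; rewrite uE !size_cat addnC eqn_add2l => /eqP.
have t0 : t <> [::] by case: (t) (x) st x0 => [[]|].
have xt : word_lt x t by move: yxu; rewrite {1}tE word_lt_cat2l.
have := su _ _ y0 t0 tE; rewrite uE => tyu.
have nx : ~~ prefix t x by apply: word_lt_prefix_size => //; rewrite st.
by have := word_lt_trans tyu (word_lt_cat y y xt nx); rewrite word_ltxx.
Qed.

Lemma suffix_standard u : u <> [::] ->
  (forall x y, u = x ++ y -> x <> [::] -> y <> [::] -> word_lt y u) -> standard u.
Proof.
move=> u0 h; split=> // x y x0 y0 uE.
have yu := h _ _ uE x0 y0; rewrite -[u]cats0; apply: word_lt_cat => //.
by apply: word_lt_prefix_size => //; rewrite uE size_cat leq_addl.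
Qed.

(** The delicate case is v = uw: cancelling u leaves w < v, which holds for a proper suffix of a
    standard word. *)
Lemma standard_lt_cat u v : u <> [::] -> standard v -> word_lt v u ->
  word_lt v (u ++ v).
Proof.
move=> u0 sv vu; have [/prefixP[w vE]|npre] := boolP (prefix u v); last first.
  by rewrite -[X in word_lt X _]cats0; apply: word_lt_cat.
rewrite {1}vE word_lt_cat2l; apply: (standard_suffix sv vE u0) => w0.
by move: vu; rewrite vE w0 cats0 word_ltxx.
Qed.

Lemma word_lt_size_prefix u v : size u < size v -> ~~ prefix v u.
Proof. by move=> h; apply/negP => /prefixP[x xE]; move: h; rewrite xE size_cat; lia. Qed.

Lemma eq_cat_split u v x y : u ++ v = x ++ y ->
  (exists z, u = x ++ z /\ y = z ++ v) \/
  (exists z, [/\ z <> [::], x = u ++ z & v = z ++ y]).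
Proof.
elim: u x => [|i u IH] [|j x] /=.
- by move=> ->; left; exists [::].
- by move=> ->; right; exists (j :: x).
- by move=> <-; left; exists (i :: u).
case=> <- /IH [[z [-> ->]]|[z [z0 -> ->]]]; first by left; exists z.
by right; exists z.
Qed.

Lemma standard_cat u v : standard u -> standard v -> word_lt v u ->
  standard (u ++ v).
Proof.
move=> su sv vu; have [u0 _] := su; have vuv := standard_lt_cat u0 sv vu.
apply: suffix_standard => [|x y xyE x0 y0]; first by case: (u) u0.
case: (eq_cat_split xyE) => [[z [uE ->]]|[z [z0 _ vE]]]; last first.
  by apply: word_lt_trans vuv; apply: (standard_suffix sv vE).
have [->|/eqP z0] := eqVneq z [::]; first exact: vuv.
apply: word_lt_cat; first exact: (standard_suffix su uE).
by apply: word_lt_size_prefix; rewrite uE size_cat; case: (x) x0 => //= *; lia.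
Qed.

Lemma standard_suffix_lt u v x y : standard (u ++ v) -> u <> [::] -> v <> [::] ->
  word_lt (v ++ x) (u ++ v ++ y).
Proof.
move=> suv u0 v0; rewrite catA; apply: word_lt_cat.
  exact: (standard_suffix suv).
by apply: word_lt_size_prefix; rewrite size_cat; case: (u) u0 => //= *; lia.
Qed.

Lemma standard_nword_erase (t : nword n) : standard_nword t -> standard (erase t).
Proof. by case: t => [i|l r] []. Qed.

Lemma standard_letter (i : 'I_n) : standard [:: i].
Proof.
apply: suffix_standard => // -[|j [|? x]] [|? y] //.
Qed.

(** A suffix that reaches into [l] begins, by induction, with a word at most the right half of [l],
    and condition (3) bounds that half by [r]. This is the obstruction behind
    [standard_nword_split]. *)
Lemma standard_nword_suffix (l r : nword n) x y : standard_nword (NPair l r) ->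
  erase l ++ erase r = x ++ y -> x <> [::] -> y <> [::] ->
  exists z y', [/\ z <> [::], y = z ++ y' & word_le z (erase r)].
Proof.
elim: l r x y => [i|l1 IH1 l2 _] r x y [std [sl sr hlr]] E x0 y0;
  (have [r0 _] := standard_nword_erase sr);
  case: (eq_cat_split E) => [[z [lE yE]]|[z [z0 _ rE]]];
  try by exists y, [::]; rewrite cats0; split=> //; apply: word_ltW;
    apply: (standard_suffix (standard_nword_erase sr) rE).
  exists (erase r), [::]; rewrite cats0 word_le_eqVlt eqxx; split=> //.
  by case: x x0 lE yE {E} => [|j [|j' x]] //= _ [_ <-].
have [zE|/eqP z0] := eqVneq z [::].
  by exists (erase r), [::]; rewrite cats0 word_le_eqVlt eqxx yE zE; split.
have [t [y' [t0 zE tl2]]] := IH1 _ _ _ sl lE x0 z0.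
exists t, (y' ++ erase r); rewrite yE zE catA; split=> //.
exact: word_le_trans tl2 hlr.
Qed.

(** The uniqueness half of Shirshov's theorem. If [l] is the longer left part, then l = l' z and r'
    = z r with z non-empty. The previous lemma gives a beginning t of z with t <= l2 <= r, so r < r'
    <= t <= r, a contradiction. *)
Lemma standard_nword_split (l r l' r' : nword n) :
  standard_nword (NPair l r) -> standard_nword (NPair l' r') ->
  erase l ++ erase r = erase l' ++ erase r' ->
  erase l = erase l' /\ erase r = erase r'.
Proof.
wlog: l r l' r' / size (erase l') <= size (erase l) => [hw s s' E|].
  have [h|/ltnW h] := leqP (size (erase l')) (size (erase l)); first exact: hw.
  by case: (hw _ _ _ _ h s' s (esym E)).
move=> hs s s' E; have [z [lE rE]] : exists z, erase l = erase l' ++ z /\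
    erase r' = z ++ erase r.
  case: (eq_cat_split E) => // -[z [z0 lE _]].
  by move: hs; rewrite lE size_cat; case: (z) z0 => //= *; lia.
have [z0|/eqP z0] := eqVneq z [::]; first by rewrite lE rE z0 cats0.
case: s' => _ [sl' sr' _]; have [l'0 _] := standard_nword_erase sl'.
case: l s lE E hs => [i|l1 l2] [_ [sl sr hlr]] lE _ _.
  by case: (erase l') l'0 lE => [|j [|j' x]] //= _ [_] zE; case: z0.
have [t [y [t0 zE tl2]]] := standard_nword_suffix sl lE l'0 z0.
have r't : word_le (erase r') t.
  rewrite rE zE -catA word_le_eqVlt; apply/orP; right; apply: word_lt_catr.
  by have [+ _] := standard_nword_erase sr; case: (y) (erase r) => [|? ?] [].
have rr' : word_lt (erase r) (erase r').
  apply: (standard_suffix (standard_nword_erase sr') rE) => //.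
  by have [] := standard_nword_erase sr.
have := word_lt_le_trans rr' (word_le_trans r't (word_le_trans tl2 hlr)).
by rewrite word_ltxx.
Qed.

End WordOrder.

(** * Gauss binomial coefficients *)

Section GaussBinomial.
Variables (k : fieldType) (q : k).

(** The q-binomial coefficient. The q-Pascal recurrence avoids division, so that it also makes sense
    at roots of unity. *)
Fixpoint gauss_binomial (m s : nat) : k :=
  match m, s with
  | _, 0 => 1
  | 0, _.+1 => 0
  | m'.+1, s'.+1 => gauss_binomial m' s' + q ^+ s * gauss_binomial m' s
  end.

Lemma gauss_binomial0 m : gauss_binomial m 0 = 1.
Proof. by case: m. Qed.

Lemma gauss_binomialS m s : gauss_binomial m.+1 s.+1 =
  gauss_binomial m s + q ^+ s.+1 * gauss_binomial m s.+1.
Proof. by []. Qed.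

Lemma gauss_binomial_small m s : (m < s)%N -> gauss_binomial m s = 0.
Proof.
elim: m s => [|m IH] [|s] // ms.
by rewrite gauss_binomialS !IH ?mulr0 ?addr0 // ltnW.
Qed.

Lemma gauss_binomialnn m : gauss_binomial m m = 1.
Proof. by elim: m => // m IH; rewrite gauss_binomialS IH gauss_binomial_small ?mulr0 ?addr0. Qed.

(** Gauss's q-binomial theorem: it converts the vanishing of Gauss binomials into an identity
    between polynomials. *)
Lemma coef_prod_XsubC_exp m s : (s <= m)%N ->
  (\prod_(0 <= i < m) ('X - (q ^+ i)%:P))`_s =
    (-1) ^+ (m - s) * q ^+ 'C(m - s, 2) * gauss_binomial m s.
Proof.
elim: m s => [|m IH] s sm.
  by move: sm; rewrite leqn0 => /eqP ->; rewrite big_geq // coef1 !mul1r.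
rewrite big_nat_recr //= mulrBr coefB coefMX coefMC.
case: s sm => [|s] sm /=.
  rewrite IH // !subn0 add0r !gauss_binomial0 exprS binS bin1 exprD.
  by ring.
rewrite IH // subSS; have [lt_sm|] := ltnP s m; last first.
  move=> ms; have -> : s = m by apply/eqP; rewrite eqn_leq ms andbT.
  rewrite subnn !gauss_binomialnn.
  rewrite [X in _ - X * _]nth_default ?mul0r ?subr0 //.
    by rewrite gauss_binomial_small // mulr0 addr0.
  by rewrite (size_prod_XsubC _ (fun i => q ^+ i)) size_iota subn0.
rewrite IH //; have -> : (m - s = (m - s.+1).+1)%N by lia.
have -> : q ^+ m = q ^+ s.+1 * q ^+ (m - s.+1) by rewrite -exprD subnKC.
rewrite binS bin1 [(-1) ^+ _.+1]exprS exprD; ring.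
Qed.

(** Compare the coefficients of X^t: up to sign it is m on the left, and it is 0 on the right
    because m > 1. *)
Lemma expr_XnB1_coef1 t m : (0 < t)%N -> (1 < m)%N ->
  ('X^t - 1) ^+ m = 'X^(t * m) - 1 :> {poly k} -> m%:R = 0 :> k.
Proof.
move=> t0 m1 E.
have e1 : ('X^t - 1) ^+ m = ('X - 1) ^+ m \Po 'X^t :> {poly k}.
  by rewrite rmorphXn rmorphB /= comp_polyX rmorph1.
have := congr1 (fun r : {poly k} => r`_t) E; rewrite e1 coef_comp_poly_Xn // dvdnn divnn t0.
have -> : (('X - 1) ^+ m)`_1 = m%:R * (-1) ^+ m.-1 :> k.
  have := coef_deriv (('X - 1) ^+ m : {poly k}) 0; rewrite mulr1n => <-.
  rewrite deriv_exp derivB derivX -polyC1 derivC subr0 mul1r coefMn.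
  by rewrite -horner_coef0 horner_exp hornerXsubC sub0r mulr_natl.
rewrite coefB coefXn coef1 (gtn_eqF t0) -{1}[t]muln1 eqn_pmul2l // (ltn_eqF m1).
by rewrite subrr => /eqP; rewrite mulf_eq0 expf_eq0 oppr_eq0 oner_eq0 andbF orbF => /eqP.
Qed.

(** By [coef_prod_XsubC_exp] the product of X - q^i over i < N is X^N plus a constant. Since 1 is a
    root it is X^N - 1, and q is a root because N > 1. Let t be the order of q and N = tM. Blocks of
    t factors give (X^t - 1)^M = X^(tM) - 1, so if M > 1 the characteristic l is positive and
    divides M. Write M = m l^e with m prime to l. Frobenius absorbs l^e, and if m > 1 the same
    coefficient comparison would make l divide m. *)
Lemma gauss_binomial_vanish N : (1 < N)%N ->
  (forall s, (0 < s < N)%N -> gauss_binomial N s = 0) ->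
  exists t, t.-primitive_root q /\
    (N = t \/ exists l e, l \in [pchar k] /\ N = (t * l ^ e)%N).
Proof.
move=> N1 vanish; have N0 := ltnW N1.
pose r : {poly k} := \prod_(0 <= i < N) ('X - (q ^+ i)%:P).
have sz : size r = N.+1.
  by rewrite /r (size_prod_XsubC _ (fun i => q ^+ i)) size_iota subn0.
have rE : r = 'X^N + (r`_0)%:P.
  apply/polyP => i; rewrite coefD coefXn coefC; case: (ltngtP i N) => [iN|Ni|->].
  - case: i iN => [|i] iN; first by rewrite add0r.
    by rewrite coef_prod_XsubC_exp 1?ltnW // vanish ?iN // mulr0 addr0.
  - by rewrite nth_default ?sz // (gtn_eqF (leq_trans _ Ni)) ?addr0.
  - rewrite coef_prod_XsubC_exp // subnn gauss_binomialnn (gtn_eqF N0) addr0.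
    by rewrite !mulr1.
have root_r i : (i < N)%N -> r.[q ^+ i] = 0.
  move=> iN; apply/eqP; rewrite -/(root r _) /r big_mkord.
  rewrite (bigD1 (Ordinal iN)) //= rootM root_XsubC eqxx //.
have r1 : r = 'X^N - 1.
  have := root_r 0 N0; rewrite {1}rE !hornerE expr1n => /eqP.
  by rewrite addrC addr_eq0 => /eqP r0; rewrite rE r0 polyCN.
have qN : q ^+ N = 1.
  by have := root_r 1 N1; rewrite r1 !hornerE => /eqP; rewrite subr_eq0 => /eqP.
have [t qt /dvdnP[M NE]] := prim_order_exists N0 qN.
exists t; split=> //; have t0 := prim_order_gt0 qt.
have M0 : (0 < M)%N by move: N0; rewrite NE muln_gt0 => /andP[].
have rM : ('X^t - 1) ^+ M = 'X^(t * M) - 1 :> {poly k}.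
  rewrite mulnC -NE -r1 /r NE big_nat_mul.
  rewrite -(factor_Xn_sub_1 qt) -[M in LHS]subn0 -prodr_const_nat.
  apply: eq_bigr => i _; rewrite -[X in _ = \big[_/_]_(X <= _ < _) _]add0n big_addn mulSn addnK.
  by apply: eq_bigr => j _; rewrite exprD [(i * t)%N]mulnC exprM (prim_expr_order qt) expr1n mulr1.
have [M1|] := leqP M 1; first by left; rewrite NE (eqP (_ : M == 1)%N) ?mul1n // eqn_leq M1.
move=> M1; right; have Mk0 := expr_XnB1_coef1 t0 M1 rM.
have [l lk] := natf0_pchar M0 (introT eqP Mk0).
have [lp _] := andP lk; have [m lm ME] := pfactor_coprime lp M0.
exists l, (logn l M); split=> //; rewrite NE {1}ME.
suff -> : m = 1%N by rewrite mul1n mulnC.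
have m0 : (0 < m)%N by move: M0; rewrite ME muln_gt0 => /andP[].
apply/eqP; rewrite eqn_leq m0 andbT leqNgt; apply/negP => m1.
set L := (l ^ _)%N in ME.
have frob : ('X^t - 1) ^+ L = 'X^(t * L) - 1 :> {poly k}.
  have lP : l \in [pchar {poly k}] by rewrite pchar_poly.
  apply/eqP; rewrite eq_sym subr_eq eq_sym; apply/eqP.
  rewrite exprM -[in RHS](subrK 1 'X^t) [RHS]exprDn_pchar ?expr1n //.
  by rewrite /L pnatX pnatE // lP.
have : m%:R = 0 :> k.
  apply: (expr_XnB1_coef1 (t := (t * L)%N)) => //.
    by rewrite muln_gt0 t0 expn_gt0 prime_gt0.
  by rewrite -frob -exprM -mulnA [(L * m)%N]mulnC -ME.
move/eqP; rewrite -(dvdn_pcharf lk) => lm'.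
by move: lm; rewrite prime_coprime // lm'.
Qed.

End GaussBinomial.

Section GaussExpansion.
Variables (k : fieldType) (A : algType k).

Lemma tens_expr (x y : A) m : (x \ox y) ^+ m = (x ^+ m) \ox (y ^+ m).
Proof. by elim: m => // m IH; rewrite !exprS IH tensM. Qed.

(** Multiplying by X + Y on the right and moving Y through X^s costs q^s, which reproduces the
    recurrence of [gauss_binomial]. *)
Lemma tens_gauss_expansion (X Y : tensor A A) (q : k) m : X * Y = q *: (Y * X) ->
  (X + Y) ^+ m = \sum_(s < m.+1) gauss_binomial q m s *: (Y ^+ (m - s) * X ^+ s).
Proof.
move=> XY; have XsY s : X ^+ s * Y = q ^+ s *: (Y * X ^+ s).
  elim: s => [|s IH]; first by rewrite mul1r mulr1 scale1r.
  by rewrite exprS -mulrA IH -tens_scalerAr mulrA XY -tens_scalerAl scalerA -mulrA -exprSr.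
elim: m => [|m IH]; first by rewrite big_ord_recl big_ord0 addr0 mulr1 scale1r.
rewrite exprSr IH mulr_suml [RHS]big_ord_recl [X in _ = _ + X]big_ord_recr /=.
under eq_bigr => s _.
  rewrite mulrDr -!tens_scalerAl -mulrA -exprSr -mulrA XsY -tens_scalerAr mulrA -exprSr scalerA.
  over.
rewrite big_split /= [X in _ + X]big_ord_recl [X in X + _]big_ord_recr /=.
rewrite gauss_binomial0 gauss_binomialnn subn0 !mulr1 !scale1r.
rewrite /bump /= !add1n !subnn !mul1r gauss_binomial_small // mulr0 addr0 scale1r.
rewrite addrCA; congr (_ + _); rewrite addrAC; congr (_ + _).
rewrite -big_split; apply: eq_bigr => i _ /=.
by rewrite !add1n add0n subSS subnSK // scalerDl [_ * q ^+ _]mulrC.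
Qed.

End GaussExpansion.

(** * Group-like elements *)

Section Grouplike.
Variables (k : fieldType) (H : hopfAlgType k).
Implicit Types (x y h : H).

Lemma grouplike1 : grouplike (1 : H).
Proof. by split; rewrite rmorph1. Qed.

Lemma grouplikeM x y : grouplike x -> grouplike y -> grouplike (x * y).
Proof.
move=> [cx ex] [cy ey]; split; last by rewrite rmorphM /= ex ey mulr1.
by rewrite rmorphM /= cx cy tensM.
Qed.

Lemma antipode_grouplikel h : grouplike h -> antipode h * h = 1.
Proof.
move=> [ch eh]; have := antipodel h; rewrite ch eh scale1r => <-.
rewrite tensor_lift_tens //; split=> [v c u u'|u c v v'].
  by rewrite linearP mulrDl scalerAl.
by rewrite mulrDr scalerAr.
Qed.

Lemma character1 (chi : H -> k) : is_character chi -> chi 1 = 1.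
Proof.
move=> [nz mul]; have := mul _ _ grouplike1 grouplike1; rewrite mulr1 => /eqP.
by rewrite -{1}[chi 1]mulr1 (inj_eq (mulfI (nz _ grouplike1))) eq_sym => /eqP.
Qed.

Lemma grouplike_antipode h : grouplike h -> grouplike (antipode h).
Proof.
move=> gh; have Sh := antipode_grouplikel gh; have [ch eh] := gh.
have hS : h * antipode h = 1.
  have := antipoder h; rewrite ch eh scale1r => <-.
  rewrite tensor_lift_tens //; split=> [v c u u'|u c v v'].
    by rewrite mulrDl scalerAl.
  by rewrite linearP mulrDr scalerAr.
split.
  rewrite -[LHS]mul1r -[1]/(1 \ox 1) -{1 2}Sh -tensM -ch -mulrA -rmorphM hS.
  by rewrite rmorph1 mulr1.
by have := congr1 counit Sh; rewrite rmorphM rmorph1 /= eh mulr1.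
Qed.

(** Inductively the elements of [s] are independent, so some phi is 1 at x and 0 at the others. If h
    is the sum of the e_x x, applying phi (x) id to its coproduct gives e_x x = e_x h, so e_x = 0.
    Then h = 0, against counit h = 1. *)
Lemma grouplike_notin (s : seq H) h : uniq s -> (forall x, x \in s -> grouplike x) ->
  grouplike h -> h \notin s -> ~ lin_comb (fun x => x \in s) h.
Proof.
have [m] := ubnP (size s); elim: m s h => // m IH s h sm us gs gh hs hin.
have [e hE] := lin_comb_seq hin us; have [ch eh] := gh.
have e0 x : x \in s -> e x = 0.
  move=> xs; have : ~ lin_comb (fun y => y \in rem x s) x.
    apply: IH; rewrite ?rem_uniq //.
    - by rewrite size_rem // -ltnS prednK //; case: (s) xs.
    - by move=> y /mem_rem /gs.
    - exact: gs.
    - by rewrite mem_rem_uniqF.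
  move=> /(separating_functional (lin_comb_subspace _)) [phi [lphi phix phi0]].
  have phiE y : y \in s -> phi y = (y == x)%:R.
    move=> ys; have [->|yx] := eqVneq y x; first by rewrite phix.
    by apply/phi0/lin_comb_incl; rewrite mem_rem_uniq // inE yx.
  have := congr1 (tensor_evall phi) ch.
  rewrite tensor_evallE // {1}hE (linear_sumZ _ _ _ (@comul_linear k H)).
  rewrite (linear_sumZ _ _ _ (tensor_evall_linear lphi)).
  have phih : phi h = e x.
    rewrite hE (linear_sumZ (W := k^o) _ _ _ lphi) (bigD1_seq x) //= phix big_seq_cond.
    rewrite big1 ?addr0 => [|y /andP[ys yx]]; first exact: mulr1.
    by rewrite phiE // (negbTE yx) scaler0.
  rewrite (bigD1_seq x) //= big_seq_cond big1 ?addr0 => [|y /andP[ys yx]]; last first.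
    by have [-> _] := gs _ ys; rewrite tensor_evallE // phiE // (negbTE yx) scale0r scaler0.
  have [-> _] := gs _ xs; rewrite tensor_evallE // phix scale1r phih => /eqP.
  rewrite -subr_eq0 -scalerBr scaler_eq0 subr_eq0 => /orP[/eqP //|/eqP xh].
  by rewrite -xh xs in hs.
have h0 : h = 0 by rewrite hE big_seq big1 // => i /e0 ->; rewrite scale0r.
by move: eh; rewrite h0 linear0 => /eqP; rewrite eq_sym oner_eq0.
Qed.

Lemma grouplike_independent h : grouplike h ->
  ~ lin_comb (fun x => grouplike x /\ x <> h) h.
Proof.
move=> gh [s hs hE]; pose t := undup [seq q.2 | q <- s].
have tP x : x \in t -> grouplike x /\ x <> h.
  by rewrite mem_undup => /mapP[q /hs[gq qh] ->].
apply: (@grouplike_notin t h) => //; first exact: undup_uniq.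
- by move=> x /tP[].
- by apply/negP => /tP[_].
rewrite hE big_seq; apply: subspace_sum => [|q qs]; first exact: lin_comb_subspace.
by apply/lin_combZ/lin_comb_incl; rewrite mem_undup map_f.
Qed.

End Grouplike.

(** * Super-words and skew commutators *)

Section Superwords.
Variables (k : fieldType) (H : hopfAlgType k) (n : nat).
Variables (a g : 'I_n -> H) (chi : 'I_n -> H -> k).
Hypothesis G_abelian : forall x y : H, grouplike x -> grouplike y -> x * y = y * x.
Hypothesis a_semi_inv : forall i, skew_primitive_semi_invariant (a i) (g i) (chi i).

Local Notation word := (seq 'I_n).
Implicit Types (u v w z : word) (W : seq word) (h x y : H).
Local Notation wg := (word_grouplike g).
Local Notation wc := (word_char chi).
Local Notation p := (p_ g chi).
Local Notation sl := (super_letter a g chi).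
Local Notation sv := (sw_val a g chi).

Lemma grouplike_wg u : grouplike (wg u).
Proof.
apply: (big_ind (@grouplike k H)) => [||i _]; first exact: grouplike1.
  exact: grouplikeM.
by case: (a_semi_inv i).
Qed.

Lemma wg_cat u v : wg (u ++ v) = wg u * wg v.
Proof. exact: big_cat. Qed.

Lemma wg_perm u v : perm_eq u v -> wg u = wg v.
Proof.
move=> uv; apply: (catCA_perm_ind (P := fun w => wg u = wg w) _ uv) => //.
move=> s1 s2 s3 ->; rewrite !wg_cat !mulrA; congr (_ * _).
exact/G_abelian/grouplike_wg/grouplike_wg.
Qed.

Lemma wc_cat u v h : wc (u ++ v) h = wc u h * wc v h.
Proof. exact: big_cat. Qed.

Lemma wc_perm u v h : perm_eq u v -> wc u h = wc v h.
Proof. by move=> uv; apply: perm_big. Qed.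

Lemma wc_mul u x y : grouplike x -> grouplike y -> wc u (x * y) = wc u x * wc u y.
Proof.
move=> gx gy; rewrite /word_char -big_split; apply: eq_bigr => i _.
by case: (a_semi_inv i) => _ [_ ->].
Qed.

Lemma wc_1 u : wc u 1 = 1.
Proof.
rewrite /word_char big1 // => i _.
by case: (a_semi_inv i) => _ /character1.
Qed.

Lemma p_catl u v w : p (u ++ v) w = p u w * p v w.
Proof. exact: wc_cat. Qed.

Lemma p_catr u v w : p u (v ++ w) = p u v * p u w.
Proof. by rewrite /p_ wg_cat wc_mul //; apply: grouplike_wg. Qed.

Lemma p_permr u v w : perm_eq v w -> p u v = p u w.
Proof. by move=> vw; rewrite /p_ (wg_perm vw). Qed.

Lemma p_nilr u : p u [::] = 1.
Proof. by rewrite /p_ /word_grouplike big_nil wc_1. Qed.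

Lemma standard_nword_uniq (t t' : nword n) : standard_nword t ->
  standard_nword t' -> erase t = erase t' -> t = t'.
Proof.
have pair i (l r : nword n) : standard_nword (NPair l r) ->
    erase l ++ erase r <> [:: i].
  case=> _ [/standard_nword_erase[l0 _] /standard_nword_erase[r0 _] _].
  by case: (erase l) l0 => // j [|//] _; case: (erase r) r0.
elim: t t' => [i|l IHl r IHr] [j|l' r'] s s' E; first by case: E => ->.
- by case: (pair i _ _ s'); apply/esym/E.
- by case: (pair j _ _ s); apply: E.
have [El Er] := standard_nword_split s s' E.
case: s s' => _ [sl sr _] [_ [sl' sr' _]].
by rewrite (IHl l') // (IHr r').
Qed.

Lemma super_letter_erase t : standard_nword t ->
  sl (erase t) = nword_val a g chi t.
Proof.
move=> st; rewrite /super_letter; case: xgetP => [y -> /= [t' [st' E] ->]|].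
  by rewrite (standard_nword_uniq st' st E).
by move=> /(_ (nword_val a g chi t)) []; exists t.
Qed.

(** Prepares inductions over bracketings: for the default value 0 the claims to be proved are
    immediate. *)
Lemma super_letter_cases u : sl u = 0 \/ exists2 t, standard_nword t & erase t = u.
Proof.
rewrite /super_letter; case: xgetP => [y -> /= [t [st E] _]|]; last by left.
by right; exists t.
Qed.

Lemma super_letter1 i : sl [:: i] = a i.
Proof.
by rewrite (super_letter_erase (t := NLetter i)) //; split=> //; apply: standard_letter.
Qed.

Lemma super_letter_pair l r : standard_nword (NPair l r) ->
  sl (erase l ++ erase r) = sl (erase l) * sl (erase r)
    - p (erase l) (erase r) *: (sl (erase r) * sl (erase l)).
Proof.
move=> s; rewrite (super_letter_erase s) /=.
by case: s => _ [s s' _]; rewrite !super_letter_erase.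
Qed.

Lemma super_letterJ u h : grouplike h -> sl u * h = wc u h *: (h * sl u).
Proof.
move=> gh; have [->|[t st <-]] := super_letter_cases u.
  by rewrite mul0r mulr0 scaler0.
elim: t st => [i|l IHl r IHr] st.
  by rewrite super_letter1 /word_char big_seq1; case: (a_semi_inv i) => _ _ _ ->.
rewrite /= super_letter_pair // wc_cat; case: st => _ [/IHl {}IHl /IHr {}IHr _].
rewrite mulrBl mulrBr scalerBr -!mulrA IHr -!scalerAl -!scalerAr -!mulrA IHl.
rewrite -!scalerAr !mulrA IHl IHr -!scalerAl !scalerA; congr (_ *: _ - _ *: _).
by rewrite mulrC.
by rewrite -mulrA mulrC.
Qed.

Lemma sw_val_cons u W : sv (u :: W) = sl u * sv W.
Proof. exact: big_cons. Qed.

Lemma sw_val_cat W W' : sv (W ++ W') = sv W * sv W'.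
Proof. exact: big_cat. Qed.

Lemma sw_val1 u : sv [:: u] = sl u.
Proof. exact: big_seq1. Qed.

Lemma sw_val_nil : sv [::] = 1.
Proof. exact: big_nil. Qed.

Lemma sw_valJ W h : grouplike h -> sv W * h = wc (flatten W) h *: (h * sv W).
Proof.
move=> gh; elim: W => [|u W IH] /=.
  by rewrite sw_val_nil mul1r mulr1 /word_char big_nil scale1r.
rewrite sw_val_cons -mulrA IH -scalerAr !mulrA.
by rewrite (super_letterJ _ gh) wc_cat -scalerAl scalerA [wc u h * _]mulrC.
Qed.

Lemma is_super_word_cons u W : is_super_word (u :: W) <-> standard u /\ is_super_word W.
Proof.
split=> [h|[su sW] v]; last by rewrite inE => /orP[/eqP ->|/sW].
by split=> [|v vW]; apply: h; rewrite inE ?eqxx // vW orbT.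
Qed.

Lemma is_super_word_cat W W' :
  is_super_word (W ++ W') <-> is_super_word W /\ is_super_word W'.
Proof.
split=> [h|[sW sW'] v]; last by rewrite mem_cat => /orP[/sW|/sW'].
by split=> v vW; apply: h; rewrite mem_cat vW ?orbT.
Qed.

(* Up to permutation, z is the constitution of the super-word. *)
Definition super_word_in (P : pred word) z x :=
  exists W, [/\ is_super_word W, all P W, perm_eq (flatten W) z & x = sv W].

Local Notation span P z := (lin_comb (super_word_in P z)).

Lemma span_sub (P Q : pred word) z x : subpred P Q -> span P z x -> span Q z x.
Proof.
move=> PQ; apply: lin_comb_sub => _ [W [sW PW zW ->]].
by exists W; split=> //; apply: sub_all PW.
Qed.

Lemma span_perm P z z' x : perm_eq z z' -> span P z x -> span P z' x.
Proof.
move=> zz'; apply: lin_comb_sub => _ [W [sW PW zW ->]].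
by exists W; split=> //; apply: perm_trans zz'.
Qed.

Lemma span_mul P z z' x y : span P z x -> span P z' y -> span P (z ++ z') (x * y).
Proof.
apply: lin_comb_mul => _ _ [W [sW PW zW ->]] [W' [sW' PW' zW' ->]].
apply: lin_comb_incl; exists (W ++ W'); rewrite sw_val_cat all_cat PW flatten_cat.
by split=> //; [apply/is_super_word_cat | apply: perm_cat].
Qed.

Lemma span_letter (P : pred word) u : standard u -> P u -> span P u (sl u).
Proof.
move=> su Pu; apply: lin_comb_incl; exists [:: u]; rewrite sw_val1 /= Pu cats0.
by split=> // v; rewrite inE => /eqP ->.
Qed.

(** The constitutions [z], [z'] are explicit arguments because an element of [H] does not determine
    one. *)
Definition skew z z' x y := x * y - p z z' *: (y * x).

Lemma skew_linearr z z' x : linear (skew z z' x).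
Proof.
move=> c y y'; rewrite /skew mulrDl mulrDr scalerDr opprD addrACA.
by rewrite -scalerAl -!scalerAr scalerBr !scalerA mulrC.
Qed.

Lemma skew_mulr z z1 z2 x y1 y2 : skew z (z1 ++ z2) x (y1 * y2) =
  skew z z1 x y1 * y2 + p z z1 *: (y1 * skew z z2 x y2).
Proof.
rewrite /skew p_catr mulrBl mulrBr scalerBr -!scalerAr -!scalerAl !scalerA !mulrA.
by rewrite addrA subrK.
Qed.

Lemma skew_jacobi z1 z2 z3 x y (t : H) :
  skew (z1 ++ z2) z3 (skew z1 z2 x y) t =
    skew z1 (z2 ++ z3) x (skew z2 z3 y t)
    + p z2 z3 *: (skew z1 z3 x t * y) - p z1 z2 *: (y * skew z1 z3 x t).
Proof.
rewrite /skew p_catl p_catr !mulrBl !mulrBr !scalerBr -!scalerAr -!scalerAl.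
rewrite !scalerA !mulrA !opprB ![p z2 z3 * p z1 z3]mulrC.
rewrite [RHS](AC (2*2*2*2) (1*8*(3*6)*(2*5)*(4*7))) /= !addNr !addr0.
by rewrite [_ * p z1 z2]mulrC mulrA.
Qed.

Lemma skew_span P Q z1 z z' x y :
  (forall W, is_super_word W -> all Q W -> perm_eq (flatten W) z ->
     span P z' (skew z1 (flatten W) x (sv W))) ->
  span Q z y -> span P z' (skew z1 z x y).
Proof.
move=> h; apply: lin_comb_map => [|_ [W [sW QW zW ->]]]; first exact: skew_linearr.
by rewrite /skew -(p_permr _ zW); apply: h.
Qed.

(** By [skew_mulr] the bracket with x is a skew derivation, so it expands into super-words in which
    a single letter w is replaced by its bracket with x. *)
Lemma skew_super_word (P : pred word) z x W : is_super_word W -> all P W ->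
  (forall w, w \in W -> span P (z ++ w) (skew z w x (sl w))) ->
  span P (z ++ flatten W) (skew z (flatten W) x (sv W)).
Proof.
elim: W => [|w W IH] /= => [_ _ _|/is_super_word_cons[sw sW] /andP[Pw PW] h].
  rewrite /skew p_nilr scale1r sw_val_nil mulr1 mul1r subrr.
  exact: lin_comb0.
rewrite sw_val_cons skew_mulr; apply: lin_combD.
  rewrite catA; apply: span_mul; first by apply: h; rewrite inE eqxx.
  by apply: lin_comb_incl; exists W.
apply: lin_combZ; apply: (@span_perm _ (w ++ (z ++ flatten W))).
  by rewrite !catA perm_cat2r perm_catC.
apply: span_mul; first exact: span_letter.
by apply: IH => // v vW; apply: h; rewrite inE vW orbT.
Qed.

(* If the standard bracketing of u is [u1 u2] with u2 <= v then [[u][v]] is a *)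
(* super-letter; otherwise the Jacobi identity lowers the pair (u, v). *)
Lemma skew_super_letter u v : standard u -> standard v -> word_lt v u ->
  span (fun w => word_le w (u ++ v)) (u ++ v) (skew u v (sl u) (sl v)).
Proof.
(* Induction on the total length, then on the length of u: in the Jacobi term [u1 [u2 v]] the total
   length need not drop, but the left letter becomes the shorter u1. *)
have [N] := ubnP (size u + size v); elim: N u v => // N IHN u.
have [M] := ubnP (size u); elim: M u => // M IHM u uM v uvN su sv' vu.
have IH u' v' : (size u' + size v' < (size u + size v).+1)%N ->
    (size u' < size u)%N \/ (size u' + size v' < size u + size v)%N ->
    standard u' -> standard v' -> word_lt v' u' ->
    span (fun w => word_le w (u' ++ v')) (u' ++ v') (skew u' v' (sl u') (sl v')).
  by move=> h1 [h2|h2]; [apply: IHM; lia | apply: IHN; lia].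
have [u0|[tu stu tuE]] := super_letter_cases u.
  by rewrite /skew u0 mul0r mulr0 scaler0 subr0; apply: lin_comb0.
have [v0|[tv stv tvE]] := super_letter_cases v.
  by rewrite /skew v0 mul0r mulr0 scaler0 subr0; apply: lin_comb0.
have suv := standard_cat su sv' vu.
have done_pair : standard_nword (NPair tu tv) ->
    span (fun w => word_le w (u ++ v)) (u ++ v) (skew u v (sl u) (sl v)).
  move=> spair; rewrite /skew -{3 4 5}tuE -{3 4 5}tvE -super_letter_pair // tuE tvE.
  by apply: span_letter => //; rewrite word_le_eqVlt eqxx.
case: tu => [i|l r] in stu tuE done_pair.
  by apply: done_pair; split=> /=; rewrite ?tvE ?tuE // -tuE in suv *.
have [rv|] := boolP (word_le (erase r) v).
  by apply: done_pair; split=> /=; rewrite ?tvE //= -tuE in suv *.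
rewrite word_leNgt negbK => vr {done_pair}.
have := super_letter_pair stu; case: (stu) => /= su' [sl' sr _].
move: (standard_nword_erase sl') (standard_nword_erase sr) su' tuE vr.
set u1 := erase l; set u2 := erase r => s1 s2 s12 uE vu2 slE.
rewrite -uE slE -/(skew u1 u2 (sl u1) (sl u2)) skew_jacobi.
have [u10 _] := s1; have [u20 _] := s2.
have p1 : (0 < size u1)%N by case: (u1) u10.
have p2 : (0 < size u2)%N by case: (u2) u20.
have szu : size u = (size u1 + size u2)%N by rewrite -uE size_cat.
have u2u1 : word_lt u2 u1.
  apply: (word_lt_trans (standard_suffix s12 _ u10 u20)) => //.
  exact/word_lt_catr/eqP.
(* Every letter produced must be at most u1 u2 v. The suffix u2 is smaller than the standard word u1
   u2 at a distinct letter, so u2 and u2 v are small enough. *)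
have u2vuv : word_lt (u2 ++ v) (u1 ++ u2 ++ v) by apply: standard_suffix_lt.
have u2uv : word_lt u2 (u1 ++ u2 ++ v).
  by rewrite -[X in word_lt X _]cats0; apply: standard_suffix_lt.
have vu1 := word_lt_trans vu2 u2u1.
(* The letters of [u1 v] are at most u1 v, which is below u1 u2 v because v < u2 v. *)
have span1 : span (fun w => word_le w (u1 ++ u2 ++ v)) (u1 ++ v)
    (skew u1 v (sl u1) (sl v)).
  have h := IH u1 v _ _ s1 sv' vu1.
  apply: (@span_sub (fun t => word_le t (u1 ++ v))); last by apply: h; lia.
  move=> w /word_le_trans; apply; apply: word_ltW; rewrite word_lt_cat2l.
  exact: standard_lt_cat.
rewrite -catA; apply: lin_combB; first apply: lin_combD.
- have h : span (fun w => word_le w (u2 ++ v)) (u2 ++ v) (skew u2 v (sl u2) (sl v)).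
    by apply: IH => //; lia.
  apply: skew_span h.
  move=> W sW PW WE; apply: (@span_perm _ (u1 ++ flatten W)).
    by rewrite perm_cat2l.
  apply: skew_super_word => // [|w wW].
    apply: sub_all PW => w /word_le_trans; apply; exact: word_ltW.
  have wu2v : word_le w (u2 ++ v) by apply: (allP PW).
  have szw : (size w <= size u2 + size v)%N.
    by rewrite -size_cat -(perm_size WE) size_mem_flatten.
  have wu1 : word_lt w u1.
    apply: word_le_lt_trans wu2v _; apply: word_lt_trans u2u1.
    exact/word_lt_catr/eqP/(proj1 sv').
  have h := IH u1 w _ _ s1 (sW _ wW) wu1.
  apply: (@span_sub (fun t => word_le t (u1 ++ w))); last first.
    apply: h; first by rewrite szu ltnS -addnA leq_add2l.
    by left; rewrite szu -[X in (X < _)%N]addn0 ltn_add2l.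
  by move=> t /word_le_trans; apply; rewrite word_le_cat2l.
- apply: lin_combZ; apply: (@span_perm _ ((u1 ++ v) ++ u2)).
    by rewrite -catA perm_cat2l perm_catC.
  by apply: span_mul => //; apply: span_letter => //; apply: word_ltW.
apply: lin_combZ; apply: (@span_perm _ (u2 ++ (u1 ++ v))).
  by rewrite perm_catCA.
by apply: span_mul => //; apply: span_letter => //; apply: word_ltW.
Qed.

(** * The coproduct of a super-letter *)

Lemma super_word_in_mul P z z' x y : super_word_in P z x -> super_word_in P z' y ->
  super_word_in P (z ++ z') (x * y).
Proof.
move=> [W [sW PW zW ->]] [W' [sW' PW' zW' ->]].
exists (W ++ W'); rewrite sw_val_cat all_cat PW flatten_cat.
by split=> //; [apply/is_super_word_cat | apply: perm_cat].
Qed.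

Lemma super_word_in_nil P : super_word_in P [::] 1.
Proof. by exists [::]; rewrite sw_val_nil. Qed.

Lemma super_word_in_letter (P : pred word) u :
  standard u -> P u -> super_word_in P u (sl u).
Proof.
move=> su Pu; exists [:: u]; rewrite sw_val1 /= Pu cats0.
by split=> // v; rewrite inE => /eqP ->.
Qed.

Lemma super_word_in_sub (P Q : pred word) z x : subpred P Q ->
  super_word_in P z x -> super_word_in Q z x.
Proof. by move=> PQ [W [? ? ? ?]]; exists W; split=> //; apply: sub_all PQ _ _. Qed.

Lemma super_word_inJ P z x h : grouplike h -> super_word_in P z x ->
  x * h = wc z h *: (h * x).
Proof. by move=> gh [W [_ _ /wc_perm <- ->]]; apply: sw_valJ. Qed.

(** The constitution [z] is shared out between the two tensor factors, and the flags [b], [b']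
    demand a non-empty left, respectively right, share. Only the letters on the left are restricted
    by [P]. *)
Definition coproduct_term (P : pred word) (b b' : bool) z (t : tensor H H) :=
  exists z' z'' x y, [/\ super_word_in P z' x, super_word_in xpredT z'' y,
    perm_eq (z' ++ z'') z, (b ==> (z' != [::])) && (b' ==> (z'' != [::])) &
    t = (wg z'' * x) \ox y].

Lemma coproduct_term_mul P b1 b1' b2 b2' z1 z2 s t :
  lin_comb (coproduct_term P b1 b1' z1) s ->
  lin_comb (coproduct_term P b2 b2' z2) t ->
  lin_comb (coproduct_term P (b1 || b2) (b1' || b2') (z1 ++ z2)) (s * t).
Proof.
apply: lin_comb_tensor_mul => s' t' [z1' [z1'' [x1 [y1 [hx1 hy1 E1 N1 ->]]]]].
move=> [z2' [z2'' [x2 [y2 [hx2 hy2 E2 N2 ->]]]]].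
rewrite tensM -mulrA [x1 * _]mulrA (super_word_inJ (grouplike_wg z2'') hx1).
rewrite -scalerAl -scalerAr tensZl; apply/lin_combZ/lin_comb_incl.
exists (z1' ++ z2'), (z1'' ++ z2''), (x1 * x2), (y1 * y2).
split; [exact: super_word_in_mul|exact: super_word_in_mul| | |].
- by rewrite -catA (perm_trans _ (perm_cat E1 E2)) // -catA perm_cat2l perm_catCA.
- case/andP: N1 N2 => + + /andP[].
  rewrite -!size_eq0 !size_cat !addn_eq0.
  by do 4!case: eqP => _; case: b1; case: b1'; case: b2; case: b2'.
by rewrite wg_cat !mulrA.
Qed.

Lemma coproduct_term_perm P b b' z z' t : perm_eq z z' ->
  lin_comb (coproduct_term P b b' z) t -> lin_comb (coproduct_term P b b' z') t.
Proof.
move=> E; apply: lin_comb_sub => _ [z1 [z2 [x [y [hx hy E1 N ->]]]]].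
by exists z1, z2, x, y; split=> //; apply: perm_trans E.
Qed.

(** For u = u1 u2 the coproduct of the bracket is the bracket of the coproducts, each being a sum of
    three parts: A + B + C for u1 and D + E + F for u2. The pair A, D gives [u] (x) 1 and B, E gives
    g_u (x) [u], while A and E cancel because p_(u1 u2) is exactly the factor for moving [u1] past
    g_u2. In the remaining pairs with B or C all left letters are below u. In the pair A, F the
    letter u1 exceeds u, but it enters only through brackets with letters w < u2, whose letters are
    at most u1 w < u. *)
Lemma comul_super_letter u : standard u ->
  lin_comb (coproduct_term (fun w => word_lt w u) true true u)
    (comul (sl u) - sl u \ox 1 - wg u \ox sl u).
Proof.
move=> _; have [->|[t st <-]] := super_letter_cases u.
  rewrite !linear0 (linear_at0 (@tens_linearl _ H H 1)) !subr0.
  rewrite ?addr0; exact: lin_comb0.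
elim: t st => [i|l IHl r IHr] st.
  rewrite super_letter1 /word_grouplike big_seq1; case: (a_semi_inv i) => _ _ -> _.
  by rewrite addrAC addrK subrr; apply: lin_comb0.
have := super_letter_pair st; have := standard_nword_erase st.
case: st => /= _ [sl' sr _]; move: (IHl sl') (IHr sr) => {IHl IHr}.
move: (standard_nword_erase sl') (standard_nword_erase sr).
set u1 := erase l; set u2 := erase r; set x := sl u1; set y := sl u2.
set C := comul x - _ - _; set F := comul y - _ - _.
move=> s1 s2 hC hF s12 ->.
have [u10 _] := s1; have [u20 _] := s2.
set P := fun w => word_lt w (u1 ++ u2).
have Pu2 : P u2 by apply: (standard_suffix s12 _ u10 u20).
have u2u1 : word_lt u2 u1.
  by apply: (word_lt_trans Pu2); apply/word_lt_catr/eqP.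
set q := p u1 u2.
pose sk (s t : tensor H H) := s * t - q *: (t * s).
have skDl s s' t : sk (s + s') t = sk s t + sk s' t.
  by rewrite /sk mulrDl mulrDr scalerDr opprD addrACA.
have skDr s t t' : sk s (t + t') = sk s t + sk s t'.
  by rewrite /sk mulrDl mulrDr scalerDr opprD addrACA.
set A := x \ox 1 in C hC *; set B := wg u1 \ox x in C hC *.
set D := y \ox 1 in F hF *; set E := wg u2 \ox y in F hF *.
have xE : comul x = A + (B + C) by rewrite /C [B + _]addrC subrK addrC subrK.
have yE : comul y = D + (E + F) by rewrite /F [E + _]addrC subrK addrC subrK.
have -> : comul (x * y - q *: (y * x)) = sk (comul x) (comul y).
  by rewrite linearB linearZ /= !rmorphM.
have AD : sk A D = (x * y - q *: (y * x)) \ox 1.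
  rewrite /sk !tensM mulr1 [x * y - _]addrC -[- (q *: (y * x))]scaleNr.
  by rewrite tens_linearl scaleNr addrC.
have BE : sk B E = wg (u1 ++ u2) \ox (x * y - q *: (y * x)).
  rewrite /sk !tensM -(G_abelian (grouplike_wg _) (grouplike_wg u2)) -wg_cat.
  by rewrite linearB /= tensZr.
have AE : sk A E = 0.
  rewrite /sk !tensM mul1r mulr1 (super_letterJ _ (grouplike_wg _)) tensZl.
  exact: subrr.
clearbody C F; rewrite xE yE !(skDl, skDr) AD BE AE add0r.
set X := _ \ox 1; set Y := _ \ox _ in BE *.
rewrite [X in lin_comb _ X](AC (2*((1*2)*(1*2))*1*1) ((1*9)*(4*10)*2*3*5*6*7*8)).
rewrite /= !subrr !add0r {X Y AD BE AE}.
have skP b1 b1' b2 b2' s t :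
    lin_comb (coproduct_term P b1 b1' u1) s ->
    lin_comb (coproduct_term P b2 b2' u2) t ->
    lin_comb (coproduct_term P (b1 || b2) (b1' || b2') (u1 ++ u2)) (sk s t).
  move=> hs ht; apply: lin_combB; first exact: coproduct_term_mul.
  apply: lin_combZ; rewrite orbC [b1' || _]orbC.
  apply: (@coproduct_term_perm _ _ _ (u2 ++ u1)); first by rewrite perm_catC.
  exact: coproduct_term_mul.
have tD : lin_comb (coproduct_term P true false u2) D.
  apply: lin_comb_incl; exists u2, [::], y, 1; rewrite cats0 /word_grouplike big_nil.
  rewrite mul1r; split=> //; [exact: super_word_in_letter|exact: super_word_in_nil|].
  by rewrite andbT; apply/eqP.
have right w : standard w ->
    lin_comb (coproduct_term P false true w) (wg w \ox sl w).
  move=> sw; apply: lin_comb_incl; exists [::], w, 1, (sl w); rewrite mulr1.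
  split=> //; [exact: super_word_in_nil|exact: super_word_in_letter|].
  by apply/eqP; case: sw.
have tF : lin_comb (coproduct_term P true true u2) F.
  apply: lin_comb_sub hF => _ [z' [z'' [s [t [hs ht E0 N ->]]]]].
  exists z', z'', s, t; split=> //; apply: super_word_in_sub hs => w wu2.
  exact: word_lt_trans Pu2.
have tC : lin_comb (coproduct_term P true true u1) C.
  apply: lin_comb_sub hC => _ [z' [z'' [s [t [hs ht E0 N ->]]]]].
  exists z', z'', s, t; split=> //.
  case: hs => W [sW PW zW ->]; exists W; split=> //; apply/allP => w wW.
  (* The letter w is shorter than u1, so w < u1 is decided at a distinct letter and remains true
     when u2 is appended to u1. *)
  rewrite /P -[w]cats0; apply: word_lt_cat; first exact: (allP PW).
  apply: word_lt_size_prefix; rewrite -(perm_size E0) size_cat.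
  have := size_mem_flatten wW; rewrite (perm_size zW) => /leq_ltn_trans; apply.
  by case/andP: N => _; case: (z'') => //= *; rewrite addnS ltnS leq_addr.
have tE := right _ s2; have tB := right _ s1.
apply: lin_combD; last exact: (skP _ _ _ _ _ _ tC tF).
apply: lin_combD; last exact: (skP _ _ _ _ _ _ tC tE).
apply: lin_combD; last exact: (skP _ _ _ _ _ _ tC tD).
apply: lin_combD; last exact: (skP _ _ _ _ _ _ tB tF).
apply: lin_combD; last exact: (skP _ _ _ _ _ _ tB tD).
move: hF; apply: lin_comb_map => [c s t|_ [z' [z'' [s [t [hs ht E0 N ->]]]]]].
  rewrite /sk mulrDl mulrDr scalerDr opprD addrACA.
  by rewrite -tens_scalerAl -!tens_scalerAr scalerBr !scalerA mulrC.
(* Since z' z'' is a permutation of u2, p_(u1 u2) factors over z' and z''. The z'' part pays for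
   moving [u1] past the group-like, and the rest is a bracket inside the left factor. *)
have -> : sk A ((wg z'' * s) \ox t) = p u1 z'' *: ((wg z'' * skew u1 z' x s) \ox t).
  rewrite /sk !tensM mul1r mulr1 mulrA (super_letterJ _ (grouplike_wg _)) -/x.
  rewrite -scalerAl tensZl mulrBr -scalerAr tensBl tensZl scalerBr scalerA -!mulrA.
  by rewrite /q -(p_permr _ E0) p_catr [p u1 z' * _]mulrC.
apply: lin_combZ; case: hs => W [sW PW zW ->]; rewrite /skew -(p_permr _ zW).
have hsk : span P (u1 ++ flatten W) (skew u1 (flatten W) x (sv W)).
  apply: skew_super_word => // [|w wW].
    by apply: sub_all PW => w wu2; apply: word_lt_trans Pu2.
  have wu2 : word_lt w u2 by apply: (allP PW).
  apply: (@span_sub (fun v => word_le v (u1 ++ w))); last first.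
    exact: skew_super_letter s1 (sW _ wW) (word_lt_trans wu2 u2u1).
  by move=> v vle; apply: word_le_lt_trans vle _; rewrite /P word_lt_cat2l.
move: hsk; apply: (lin_comb_map (f := fun y => (wg z'' * y) \ox t)) => [c y1 y2|y1 hy1].
  by rewrite mulrDr -scalerAr tens_linearl.
apply: lin_comb_incl; exists (u1 ++ flatten W), z'', y1, t; split=> //.
  by rewrite -catA perm_cat2l; apply: perm_trans E0; rewrite perm_cat2r.
by case/andP: N => _ ->; case: (u1) u10.
Qed.

Variable d : 'I_n -> nat.
Hypothesis d_gt0 : forall i, (0 < d i)%N.
Local Notation deg := (sw_deg d).
Local Notation hard := (hard a g chi d).
Local Notation lt_height := (lt_height a g chi d).
Local Notation lower_terms := (lower_terms a g chi d).

(** * Spanning *)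

Lemma wdeg_cat u v : wdeg d (u ++ v) = (wdeg d u + wdeg d v)%N.
Proof. exact: big_cat. Qed.

Lemma wdeg_perm u v : perm_eq u v -> wdeg d u = wdeg d v.
Proof. by move=> uv; apply: perm_big. Qed.

Lemma size_le_wdeg u : (size u <= wdeg d u)%N.
Proof.
elim: u => //= i u IH; rewrite /wdeg big_cons -add1n.
exact: leq_add.
Qed.

Lemma wdeg_gt0 u : u <> [::] -> (0 < wdeg d u)%N.
Proof. by move=> u0; apply: leq_trans (size_le_wdeg u); case: u u0. Qed.

Lemma sw_deg_cons u W : deg (u :: W) = (wdeg d u + deg W)%N.
Proof. exact: big_cons. Qed.

Lemma sw_deg_cat W W' : deg (W ++ W') = (deg W + deg W')%N.
Proof. exact: big_cat. Qed.

Lemma sw_deg_nseq u m : deg (nseq m u) = (m * wdeg d u)%N.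
Proof. by rewrite /sw_deg big_nseq iter_addn_0 mulnC. Qed.

Lemma sw_deg_flatten W : deg W = wdeg d (flatten W).
Proof.
elim: W => [|u W IH]; first by rewrite /sw_deg /wdeg !big_nil.
by rewrite sw_deg_cons IH /= wdeg_cat.
Qed.

Lemma sw_val_nseq u m : sv (nseq m u) = sl u ^+ m.
Proof. by rewrite /sw_val big_nseq -Monoid.iteropE. Qed.

(** [low] is the filtration of [H] by degree, and relations are studied modulo it. *)
Definition low_term m x :=
  exists h W, [/\ grouplike h, is_super_word W, (deg W < m)%N & x = h * sv W].
Local Notation low m := (lin_comb (low_term m)).

Lemma low_sub m m' x : (m <= m')%N -> low m x -> low m' x.
Proof.
move=> mm'; apply: lin_comb_sub => _ [h [W [gh sW degW ->]]].
by exists h, W; split=> //; apply: leq_trans mm'.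
Qed.

Lemma low_mulr m x W : is_super_word W -> low m x -> low (m + deg W) (x * sv W).
Proof.
move=> sW; apply: (lin_comb_map (f := fun x => x * sv W)) => [c y z|].
  by rewrite mulrDl scalerAl.
move=> _ [h [W' [gh sW' dW' ->]]]; apply: lin_comb_incl; exists h, (W' ++ W).
split=> //; [exact/is_super_word_cat | by rewrite sw_deg_cat ltn_add2r |].
by rewrite sw_val_cat mulrA.
Qed.

Lemma low_mull m x W : is_super_word W -> low m x -> low (deg W + m) (sv W * x).
Proof.
move=> sW; apply: lin_comb_map => [c y z|]; first by rewrite mulrDr scalerAr.
move=> _ [h [W' [gh sW' dW' ->]]]; rewrite mulrA sw_valJ // -scalerAl.
apply/lin_combZ/lin_comb_incl; exists h, (W ++ W').
split=> //; [exact/is_super_word_cat | by rewrite sw_deg_cat ltn_add2l |].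
by rewrite sw_val_cat mulrA.
Qed.

Lemma low_mulg m x h : grouplike h -> low m x -> low m (h * x).
Proof.
move=> gh; apply: lin_comb_map => [c y z|]; first by rewrite mulrDr scalerAr.
move=> _ [h' [W' [gh' sW' dW' ->]]]; apply: lin_comb_incl; exists (h * h'), W'.
by split=> //; [exact: grouplikeM | rewrite mulrA].
Qed.

(** Moving [u] to the right across W' leaves a bracket whose letters are at most uv < u, so this
    copy of u is consumed. Hence the number of letters u never grows; that bound serves in the
    independence proof. *)
Lemma move_letter u W : standard u -> is_super_word W ->
  all (fun w => word_le w u) W ->
  lin_comb (fun x => exists W' j, [/\ is_super_word W', all (fun w => word_lt w u) W',
    (deg W' + j * wdeg d u = deg W)%N, (j <= count_mem u W)%N &
    x = sv W' * sl u ^+ j]) (sv W).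
Proof.
move=> su; elim: W => [|w W IH] /= => [_ _|/is_super_word_cons[sw sW] /andP[wu Wu]].
  apply: lin_comb_incl; exists [::], 0; rewrite sw_val_nil mulr1; split=> //.
  exact: addn0.
rewrite sw_val_cons; apply: lin_comb_map (IH sW Wu) => [c y z|].
  by rewrite mulrDr scalerAr.
move=> _ [W' [j [sW' W'u dW' jm ->]]]; rewrite mulrA.
have [->|wNu] := eqVneq w u; last first.
  have {}wu : word_lt w u by move: wu; rewrite word_le_eqVlt (negbTE wNu).
  apply: lin_comb_incl; exists (w :: W'), j; rewrite sw_val_cons /= wu W'u.
  by split=> //; [exact/is_super_word_cons | rewrite !sw_deg_cons -addnA dW'].
have -> : sl u * sv W' = skew u (flatten W') (sl u) (sv W')
    + p u (flatten W') *: (sv W' * sl u) by rewrite /skew subrK.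
rewrite mulrDl; apply: lin_combD; last first.
  rewrite -scalerAl -mulrA -exprS; apply/lin_combZ/lin_comb_incl; exists W', j.+1.
  split=> //.
  by rewrite sw_deg_cons -dW' mulSn addnCA.
have : span (fun w => word_lt w u) (u ++ flatten W') (skew u (flatten W') (sl u) (sv W')).
  apply: skew_super_word => // v vW'; have vu : word_lt v u by apply: (allP W'u).
  apply: (@span_sub (fun w => word_le w (u ++ v))); last first.
    exact: skew_super_letter su (sW' _ vW') vu.
  move=> t /word_le_lt_trans; apply; apply/word_lt_catr/eqP.
  by case: (sW' _ vW').
apply: (lin_comb_map (f := fun x => x * sl u ^+ j)) => [c y z|].
  by rewrite mulrDl scalerAl.
move=> _ [W1 [sW1 W1u W1E ->]]; apply: lin_comb_incl; exists W1, j; split=> //.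
  by rewrite sw_deg_cons -dW' sw_deg_flatten (wdeg_perm W1E) wdeg_cat -sw_deg_flatten addnA.
by rewrite (leq_trans jm) // leq_addl.
Qed.

(* monotonic_restricted_hard, without the group-like prefix. *)
Definition pbw (l : seq (word * nat)) :=
  sorted (@word_lt n) [seq q.1 | q <- l] /\
  forall q, q \in l -> [/\ hard q.1, (0 < q.2)%N & lt_height q.1 q.2].
Definition pbw_val (l : seq (word * nat)) := \prod_(q <- l) sl q.1 ^+ q.2.
Definition pbw_deg (l : seq (word * nat)) := (\sum_(q <- l) q.2 * wdeg d q.1)%N.
Definition below u (l : seq (word * nat)) := all (fun q => word_lt q.1 u) l.
Definition add_power u m (l : seq (word * nat)) :=
  if m is 0 then l else rcons l (u, m).

Lemma pbw_val_add u m l : pbw_val (add_power u m l) = pbw_val l * sl u ^+ m.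
Proof. by case: m => [|m] /=; rewrite ?mulr1 // /pbw_val -cats1 big_cat big_seq1. Qed.

Lemma pbw_deg_add u m l : pbw_deg (add_power u m l) = (pbw_deg l + m * wdeg d u)%N.
Proof. by case: m => [|m] /=; rewrite ?addn0 // /pbw_deg -cats1 big_cat big_seq1. Qed.

Lemma word_lt_rev_trans : transitive (@word_lt n).
Proof. by move=> v u w; apply: word_lt_trans. Qed.

Lemma pbw_add u m l : pbw l -> below u l -> ((0 < m)%N -> hard u /\ lt_height u m) ->
  pbw (add_power u m l).
Proof.
move=> [sl' hl] lu; case: m => [|m] // /(_ isT) [hu um]; split=> [|q].
  rewrite /= map_rcons -cats1 (sorted_pairwise word_lt_rev_trans) pairwise_cat.
  rewrite -(sorted_pairwise word_lt_rev_trans) sl' /= andbT.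
  by rewrite allrel1r all_map.
by rewrite mem_rcons inE => /orP[/eqP ->|/hl].
Qed.

Definition reduced D u x :=
  (exists l, [/\ pbw l, below u l, pbw_deg l = D & x = pbw_val l]) \/ low_term D x.
Definition reducible D u := forall W, is_super_word W -> all (fun w => word_lt w u) W ->
  deg W = D -> lin_comb (reduced D u) (sv W).
Definition reduced_pow D u m x :=
  (exists l j, [/\ pbw (add_power u j l), below u l,
     pbw_deg (add_power u j l) = D, (j <= m)%N & x = pbw_val (add_power u j l)])
  \/ low_term D x.

(** Take j = 1 if [u] is not hard and j equal to the height otherwise. Its positivity makes the
    exponent drop in [reduce_power]. *)
Lemma letter_power_lower u m : standard u -> ~ (hard u /\ lt_height u m) -> (0 < m)%N ->
  exists j, [/\ (0 < j)%N, (j <= m)%N &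
    lin_comb (lower_terms u (j * wdeg d u)) (sl u ^+ j)].
Proof.
move=> su nhu m0; have [hu|nu] := pselect (hard u); last first.
  exists 1; split=> //; rewrite mul1n expr1.
  by apply: contrapT => nl; apply: nu.
have : ~ lt_height u m by move=> hm; apply: nhu.
rewrite /Defs.lt_height /Defs.height; case: pselect => // exh.
case: ex_minnP => j /asboolP [[t [pt tj]] lj] _ /negP; rewrite -leqNgt => jm.
exists j; split=> //; have t0 := prim_order_gt0 pt.
case: tj => [->|[l [e [lp ->]]]] //.
by rewrite muln_gt0 t0 expn_gt0 prime_gt0 //; case/andP: lp.
Qed.

(** Induction on the exponent j left by [move_letter]. If [u]^j is admissible, the word before it
    has smaller degree and is reduced first. Otherwise a factor [u]^i is replaced by smaller letters
    and terms of lower degree, so that j becomes j - i. *)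
Lemma reduce_power D u : standard u -> (forall D' v, (D' < D)%N -> reducible D' v) ->
  reducible D u -> forall W, is_super_word W -> all (fun w => word_le w u) W ->
  deg W = D -> lin_comb (reduced_pow D u (count_mem u W)) (sv W).
Proof.
move=> su IH IHu W sW Wu dW.
have := move_letter su sW Wu; move: (count_mem u W) => m.
apply: lin_comb_ind; first exact: lin_comb_subspace.
move=> x [W' [j [sW' W'u dW' jm ->]]] {x}; rewrite dW in dW'.
elim/ltn_ind: j W' sW' W'u dW' jm {W sW Wu dW} => j IHj W sW Wu dW jm.
have u0 : (0 < wdeg d u)%N by case: su => /wdeg_gt0.
have [j0|j0] := posnP j.
  rewrite j0 mulr1; rewrite j0 mul0n addn0 in dW.
  apply: lin_comb_sub (IHu _ sW Wu dW) => x [[l [pl lu dl ->]]|lowx]; last by right.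
  by left; exists l, 0.
have [hu|nhu] := pselect (hard u /\ lt_height u j).
  have := IH (deg W) u _ W sW Wu erefl.
  rewrite -[X in (_ < X)%N]dW -[X in (X < _)%N]addn0 ltn_add2l muln_gt0 j0 u0 => /(_ isT).
  apply: (lin_comb_map (f := fun x => x * sl u ^+ j)) => [c y z|].
    by rewrite mulrDl scalerAl.
  move=> x [[l [pl lu dl ->]]|lowx].
    apply: lin_comb_incl; left; exists l, j; rewrite pbw_val_add pbw_deg_add dl.
    by split=> //; apply: pbw_add.
  apply: (lin_comb_sub (S := low_term D)); first by right.
  rewrite -dW -sw_val_nseq -sw_deg_nseq; apply: low_mulr; last exact: lin_comb_incl.
  by move=> v; rewrite mem_nseq => /andP[_ /eqP ->].
have [i [i0 ij]] := letter_power_lower su nhu j0.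
have -> : sv W * sl u ^+ j = sv W * sl u ^+ i * sl u ^+ (j - i).
  by rewrite -mulrA -exprD subnKC.
apply: (lin_comb_map (f := fun x => sv W * x * sl u ^+ (j - i))) => [c y z|x].
  by rewrite mulrDr mulrDl -scalerAr -scalerAl.
case=> [[V [sV dV Vu ->]]|[h [V [gh sV dV ->]]]].
  rewrite -sw_val_cat; apply: IHj.
  - by rewrite ltn_subrL i0.
  - exact/is_super_word_cat.
  - by rewrite all_cat Wu; apply/allP.
  - by rewrite sw_deg_cat dV -addnA -mulnDl subnKC.
  - exact: leq_trans (leq_subr _ _) jm.
apply: (lin_comb_sub (S := low_term D)); first by right.
have -> : D = (deg W + i * wdeg d u + deg (nseq (j - i) u))%N.
  by rewrite sw_deg_nseq -addnA -mulnDl subnKC.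
rewrite -sw_val_nseq; apply: low_mulr; first by move=> v; rewrite mem_nseq => /andP[_ /eqP ->].
by apply: low_mull => //; apply: lin_comb_incl; exists h, V.
Qed.
Lemma word_max W : W <> [::] -> exists2 v, v \in W & all (fun w => word_le w v) W.
Proof.
elim: W => // w W IH _; have [->|/eqP /IH[v vW Wv]] := eqVneq W [::].
  by exists w; rewrite ?inE //= word_le_eqVlt eqxx.
have [wv|] := boolP (word_le w v); first by exists v; rewrite ?inE ?vW ?orbT //= wv.
rewrite word_leNgt negbK => vw; exists w; rewrite ?inE ?eqxx //= word_le_eqVlt eqxx /=.
by apply: sub_all Wv => t /word_le_lt_trans /(_ vw) /word_ltW.
Qed.

Definition words_upto D : seq word := flatten
  [seq [seq tval t | t <- enum [set: r.-tuple 'I_n]] | r <- iota 0 D.+1].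

Lemma mem_words_upto D w : (size w <= D)%N -> w \in words_upto D.
Proof.
move=> wD; apply/flattenP; exists [seq tval t | t <- enum [set: (size w).-tuple 'I_n]].
  by apply/mapP; exists (size w) => //; rewrite mem_iota add0n ltnS.
by apply/mapP; exists (in_tuple w); rewrite // mem_enum inE.
Qed.

Lemma reducible_all D u : reducible D u.
Proof.
elim/ltn_ind: D u => D IHD u.
(* Infinitely many words may lie below u, but letters of a super-word of degree D have length at
   most D since all [d i] are positive. The induction counts only these. *)
have [m] := ubnP (count (fun w => word_lt w u) (words_upto D)).
elim: m u => // m IHm u um W sW Wu dW.
have [W0|/eqP W0] := eqVneq W [::].
  apply: lin_comb_incl; left; exists [::]; rewrite W0 sw_val_nil /pbw_val big_nil.
  split=> //.
  by rewrite -dW W0 /pbw_deg /sw_deg !big_nil.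
have [v vW Wv] := word_max W0; have vu : word_lt v u by apply: (allP Wu).
have redv : reducible D v.
  apply: IHm; rewrite -ltnS (leq_trans _ um) // ltnS.
  apply: (@count_lt _ _ _ _ v) => //; last by rewrite word_ltxx.
    by move=> w /word_lt_trans; apply.
  apply: mem_words_upto; apply: leq_trans (size_le_wdeg v) _.
  by rewrite -dW /sw_deg (big_rem v) //= leq_addr.
have IHD' D' w : (D' < D)%N -> reducible D' w by move=> h; apply: IHD.
apply: lin_comb_sub (reduce_power (sW _ vW) IHD' redv sW Wv dW) => x.
case=> [[l [j [pl lv dl _ ->]]]|lowx]; [left|by right].
exists (add_power v j l); split=> //.
have lu : below u l by apply: sub_all lv => q /word_lt_trans; apply.
by case: (j) => //= j'; rewrite /below all_rcons /= vu.
Qed.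

Definition pbw_term m x :=
  exists h l, [/\ grouplike h, pbw l, (pbw_deg l < m)%N & x = h * pbw_val l].

Lemma low_pbw m x : low m x -> lin_comb (pbw_term m) x.
Proof.
elim/ltn_ind: m x => m IH x; apply: lin_comb_ind; first exact: lin_comb_subspace.
move=> y [h [W [gh sW dW ->]]].
(* The empty word is the greatest word, so [reducible] at it restricts no standard letter. *)
have W0 : all (fun w => word_lt w [::]) W.
  by apply/allP => w /sW[/eqP w0 _]; rewrite word_lt_nilr.
have := reducible_all sW W0 erefl.
apply: lin_comb_map => [c z t|z]; first by rewrite mulrDr scalerAr.
case=> [[l [pl _ dl ->]]|lowz].
  by apply: lin_comb_incl; exists h, l; rewrite dl.
have /(IH _ dW) := low_mulg gh (lin_comb_incl lowz).
apply: lin_comb_sub => t [h' [l [gh' pl dl ->]]].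
by exists h', l; split=> //; apply: ltn_trans dW.
Qed.

Lemma low_mul m m' x y : low m x -> low m' y -> low (m + m') (x * y).
Proof.
apply: lin_comb_mul => _ _ [h [W [gh sW dW ->]]] [h' [W' [gh' sW' dW' ->]]].
rewrite -mulrA [sv W * _]mulrA sw_valJ // -!scalerAl -scalerAr.
apply/lin_combZ/lin_comb_incl; exists (h * h'), (W ++ W'); split.
- exact: grouplikeM.
- exact/is_super_word_cat.
- by rewrite sw_deg_cat -addnS leq_add // ltnW.
- by rewrite sw_val_cat !mulrA.
Qed.

Lemma low_everything
    (H_generated : generates_algebra (fun x : H => grouplike x \/ exists i, x = a i)) x :
  exists m, low m x.
Proof.
pose S : {pred H} := fun x => `[< exists m, low m x >].
suff : x \in S by move/asboolP.
have low1 h : grouplike h -> low 1 h.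
  move=> gh; apply: lin_comb_incl; exists h, [::].
  by rewrite sw_val_nil mulr1 /sw_deg big_nil.
apply: H_generated => [|y [gy|[i ->]]]; last first.
- apply/asboolP; exists (d i).+1; apply: lin_comb_incl; exists 1, [:: [:: i]].
  rewrite sw_val1 super_letter1 mul1r /sw_deg big_seq1 /wdeg big_seq1.
  split=> //; first exact: grouplike1.
  by move=> v; rewrite inE => /eqP ->; apply: standard_letter.
- by apply/asboolP; exists 1%N; apply: low1.
split=> [|c y z /asboolP[m ym] /asboolP[m' zm]|y z /asboolP[m ym] /asboolP[m' zm]].
- by apply/asboolP; exists 1%N; apply/low1/grouplike1.
- apply/asboolP; exists (m + m')%N; apply: lin_combD.
    by apply: lin_combZ; apply: low_sub ym; rewrite leq_addr.
  by apply: low_sub zm; rewrite leq_addl.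
- by apply/asboolP; exists (m + m')%N; apply: low_mul.
Qed.
(** * Linear independence *)

(** [Q] keeps track of the super-words on the two sides, whereas the group-like prefixes stay
    arbitrary. *)
Definition bidegree_term (Q : seq word -> seq word -> Prop) m (t : tensor H H) :=
  exists h h' L R, [/\ grouplike h, grouplike h', is_super_word L & is_super_word R] /\
    [/\ Q L R, (deg L + deg R = m)%N & t = (h * sv L) \ox (h' * sv R)].
Local Notation bideg Q m := (lin_comb (bidegree_term Q m)).

Lemma bideg_sub (Q Q' : seq word -> seq word -> Prop) m t :
  (forall L R, Q L R -> Q' L R) -> bideg Q m t -> bideg Q' m t.
Proof.
move=> QQ'; apply: lin_comb_sub => _ [h [h' [L [R [G4 [QLR dLR ->]]]]]].
by exists h, h', L, R; split=> //; split=> //; apply: QQ'.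
Qed.

Lemma bideg_mul (Q1 Q2 Q : seq word -> seq word -> Prop) m1 m2 s t :
  (forall L1 R1 L2 R2, Q1 L1 R1 -> Q2 L2 R2 -> Q (L1 ++ L2) (R1 ++ R2)) ->
  bideg Q1 m1 s -> bideg Q2 m2 t -> bideg Q (m1 + m2) (s * t).
Proof.
move=> hQ; apply: lin_comb_tensor_mul => s' t'.
move=> [h1 [h1' [L1 [R1 [[gh1 gh1' sL1 sR1] [q1 d1 ->]]]]]].
move=> [h2 [h2' [L2 [R2 [[gh2 gh2' sL2 sR2] [q2 d2 ->]]]]]].
rewrite tensM -!mulrA [sv L1 * _]mulrA [sv R1 * _]mulrA !sw_valJ //.
rewrite -!scalerAl -!scalerAr tensZl tensZr.
apply/lin_combZ/lin_combZ/lin_comb_incl; exists (h1 * h2), (h1' * h2'), (L1 ++ L2), (R1 ++ R2).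
split; first by split; [exact: grouplikeM|exact: grouplikeM| |]; apply/is_super_word_cat.
by split; [exact: hQ|rewrite !sw_deg_cat -d1 -d2 addnACA|rewrite !sw_val_cat !mulrA].
Qed.

Lemma bideg_tens (Q : seq word -> seq word -> Prop) h h' L R m :
  grouplike h -> grouplike h' -> is_super_word L -> is_super_word R -> Q L R ->
  (deg L + deg R = m)%N -> bideg Q m ((h * sv L) \ox (h' * sv R)).
Proof. by move=> *; apply: lin_comb_incl; exists h, h', L, R. Qed.

Lemma is_super_word1 u : standard u -> is_super_word [:: u].
Proof. by move=> su v; rewrite inE => /eqP ->. Qed.

Lemma is_super_word0 : is_super_word ([::] : seq word).
Proof. by []. Qed.

Lemma sw_deg1 u : deg [:: u] = wdeg d u.
Proof. by rewrite sw_deg_cons /sw_deg big_nil addn0. Qed.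

Lemma sw_deg0 : deg [::] = 0%N.
Proof. by rewrite /sw_deg big_nil. Qed.

Lemma bideg_left Q u : standard u -> Q [:: u] [::] -> bideg Q (wdeg d u) (sl u \ox 1).
Proof.
move=> su q.
have := bideg_tens (grouplike1 H) (grouplike1 H) (is_super_word1 su) is_super_word0 q erefl.
by rewrite sw_val1 sw_val_nil !mul1r sw_deg1 sw_deg0 addn0.
Qed.

Lemma bideg_right Q h h' W : grouplike h -> grouplike h' -> is_super_word W ->
  Q [::] W -> bideg Q (deg W) (h \ox (h' * sv W)).
Proof.
move=> gh gh' sW q; have := bideg_tens gh gh' is_super_word0 sW q erefl.
by rewrite sw_val_nil mulr1 sw_deg0.
Qed.

Lemma bideg_right1 (Q : seq word -> seq word -> Prop) w : standard w -> Q [::] [:: w] ->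
  bideg Q (wdeg d w) (wg w \ox sl w).
Proof.
move=> sw q; rewrite -sw_deg1 -[sl w]mul1r -sw_val1.
exact: bideg_right (grouplike_wg w) (grouplike1 H) (is_super_word1 sw) q.
Qed.

Lemma bideg_comul_super_letter u : standard u ->
  bideg (fun L R => [/\ all (fun w => word_lt w u) L, (0 < deg L)%N & (0 < deg R)%N])
    (wdeg d u) (comul (sl u) - sl u \ox 1 - wg u \ox sl u).
Proof.
move=> su; apply: lin_comb_sub (comul_super_letter su).
move=> _ [z' [z'' [x [y [[L [sL Lu LE ->]] [R [sR _ RE ->]] E N ->]]]]].
exists (wg z''), 1, L, R; rewrite mul1r; split.
  by split=> //; first [exact: grouplike_wg|exact: grouplike1].
have dz w z : perm_eq w z -> z != [::] -> (0 < wdeg d w)%N.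
  by move=> /wdeg_perm -> /eqP; apply: wdeg_gt0.
case/andP: N => z'0 z''0; split=> //.
  by split=> //; rewrite sw_deg_flatten; [apply: dz LE _|apply: dz RE _].
by rewrite !sw_deg_flatten (wdeg_perm LE) (wdeg_perm RE) -wdeg_cat (wdeg_perm E).
Qed.

(* If comul w = e w + r w on letters, and products of an r-term with anything are *)
(* r-terms, then comul agrees with the product of the e's up to r-terms. *)
Lemma bideg_comul_prod (Q K : seq word -> seq word -> Prop) (e : word -> tensor H H) W :
  is_super_word W ->
  (forall L1 R1 L2 R2, Q L1 R1 -> K L2 R2 -> Q (L1 ++ L2) (R1 ++ R2)) ->
  (forall L1 R1 L2 R2, K L1 R1 -> Q L2 R2 -> Q (L1 ++ L2) (R1 ++ R2)) ->
  (forall L1 R1 L2 R2, K L1 R1 -> K L2 R2 -> K (L1 ++ L2) (R1 ++ R2)) ->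
  (forall L R, Q L R -> K L R) -> K [::] [::] ->
  (forall w, w \in W -> bideg K (wdeg d w) (e w)) ->
  (forall w, w \in W -> bideg Q (wdeg d w) (comul (sl w) - e w)) ->
  bideg K (deg W) (\prod_(w <- W) e w) /\
  bideg Q (deg W) (comul (sv W) - \prod_(w <- W) e w).
Proof.
move=> sW QK KQ KK subQK K0; elim: W sW => [|w W IH] sW eK eQ.
  rewrite sw_deg0 sw_val_nil big_nil rmorph1 subrr; split; last exact: lin_comb0.
  have := @bideg_right K 1 1 [::] (grouplike1 _) (grouplike1 _) is_super_word0 K0.
  by rewrite sw_deg0 sw_val_nil mulr1.
have [||| hK hQ] := IH; first by case/is_super_word_cons: sW.
- by move=> v vW; apply: eK; rewrite inE vW orbT.
- by move=> v vW; apply: eQ; rewrite inE vW orbT.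
have w_in : w \in w :: W by rewrite inE eqxx.
rewrite sw_deg_cons sw_val_cons big_cons; split.
  by apply: bideg_mul (eK _ w_in) hK.
have -> : comul (sl w * sv W) - e w * \prod_(j <- W) e j =
    (comul (sl w) - e w) * comul (sv W)
    + e w * (comul (sv W) - \prod_(j <- W) e j).
  by rewrite rmorphM /= mulrBl mulrBr addrA subrK.
apply: lin_combD; last by apply: bideg_mul (eK _ w_in) hQ.
apply: bideg_mul QK (eQ _ w_in) _; rewrite -[comul (sv W)](subrK (\prod_(j <- W) e j)).
by apply: lin_combD => //; apply: bideg_sub hQ.
Qed.

Lemma count_letter_deg u W : (count_mem u W * wdeg d u <= deg W)%N.
Proof.
elim: W => [|w W IH]; first by rewrite sw_deg0.
by rewrite sw_deg_cons /= mulnDl leq_add //; case: eqP => [->|//]; rewrite mul1n.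
Qed.

Lemma bideg_comul h W : grouplike h -> is_super_word W ->
  bideg (fun _ _ => True) (deg W) (comul (h * sv W)).
Proof.
move=> gh sW; rewrite rmorphM /=; have [-> _] := gh.
have gt1 := grouplike1 H.
have [|||||||hK hQ] := @bideg_comul_prod (fun _ _ => True) (fun _ _ => True)
  (fun w => sl w \ox 1 + wg w \ox sl w) W sW; try done.
- move=> w /sW sw; apply: lin_combD; first exact: bideg_left.
  exact: bideg_right1.
- move=> w /sW sw; rewrite opprD addrA.
  by apply: bideg_sub (bideg_comul_super_letter sw).
rewrite -[deg W]add0n; apply: (@bideg_mul (fun _ _ => True) (fun _ _ => True)) => //.
  have := @bideg_right (fun _ _ => True) h h [::] gh gh is_super_word0 I.
  by rewrite sw_deg0 sw_val_nil mulr1.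
by rewrite -[comul (sv W)](subrK (\prod_(w <- W) (sl w \ox 1 + wg w \ox sl w))); apply: lin_combD.
Qed.

Lemma bideg_grouplike (Q : seq word -> seq word -> Prop) h m t : grouplike h ->
  bideg Q m t -> bideg Q m ((h \ox h) * t).
Proof.
move=> gh ht; rewrite -[m]add0n.
apply: (@bideg_mul (fun L R => L = [::] /\ R = [::]) Q Q) ht => [L1 R1 L2 R2 [-> ->] //|].
have := @bideg_right (fun L R => L = [::] /\ R = [::]) h h [::] gh gh is_super_word0.
by rewrite sw_deg0 sw_val_nil mulr1; apply.
Qed.

(** Only the choice of [w] (x) 1 for every letter leaves degree 0 on the right. This isolates the
    group-like prefix in [relation_prefix]. *)
Lemma bideg_comul_right h W : grouplike h -> is_super_word W ->
  bideg (fun _ R => (0 < deg R)%N) (deg W) (comul (h * sv W) - (h * sv W) \ox h).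
Proof.
move=> gh sW; rewrite rmorphM /=; have [-> _] := gh.
have gt1 := grouplike1 H.
have [|||||||hK hQ] := @bideg_comul_prod (fun _ R => (0 < deg R)%N) (fun _ _ => True)
  (fun w => sl w \ox 1) W sW; try done.
- by move=> L1 R1 L2 R2 h1 _; rewrite sw_deg_cat addn_gt0 h1.
- by move=> L1 R1 L2 R2 _ h1; rewrite sw_deg_cat addn_gt0 h1 orbT.
- by move=> w /sW sw; apply: bideg_left.
- move=> w /sW sw; rewrite -[comul _ - _](subrK (wg w \ox sl w)); apply: lin_combD.
    by apply: bideg_sub (bideg_comul_super_letter sw) => L R [].
  by apply: bideg_right1 => //; rewrite sw_deg1; apply: wdeg_gt0; case: sw.
have -> : (h * sv W) \ox h = (h \ox h) * \prod_(w <- W) (sl w \ox 1).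
  suff -> : \prod_(w <- W) (sl w \ox (1 : H)) = sv W \ox 1 by rewrite tensM mulr1.
  elim: (W) => [|w V IH]; first by rewrite big_nil sw_val_nil.
  by rewrite big_cons IH tensM sw_val_cons mulr1.
by rewrite -mulrBr; apply: bideg_grouplike.
Qed.

(* L carries some degree besides that of its letters u, so that for a left factor *)
(* of degree s deg(u) it contains fewer than s of them. *)
Definition left_defect u (L R : seq word) : Prop :=
  all (fun w => word_le w u) L /\ (count_mem u L * wdeg d u < deg L)%N.

(** Keep [u] (x) 1 + g_u (x) [u] for the letter u and only g_w (x) [w] for w < u. Each dropped term
    contributes letters below u of positive degree on the left, which is [left_defect]. The two
    summands kept for u commute up to p_uu, so their power expands with Gauss binomials. *)
Lemma comul_leading u W m h : standard u -> is_super_word W ->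
  all (fun w => word_lt w u) W -> grouplike h ->
  bideg (left_defect u) (deg W + m * wdeg d u) (comul (h * (sv W * sl u ^+ m)) -
    \sum_(s < m.+1) gauss_binomial (p u u) m s *:
      ((h * wg (flatten W) * wg u ^+ (m - s) * sl u ^+ s) \ox (h * (sv W * sl u ^+ (m - s))))).
Proof.
move=> su sW Wu gh.
set X := sl u \ox (1 : H); set Y := wg u \ox sl u.
pose e w := if w == u then X + Y else wg w \ox sl w.
have su0 : u != [::] by apply/eqP; case: su.
have sWu : is_super_word (W ++ nseq m u).
  by apply/is_super_word_cat; split=> // v; rewrite mem_nseq => /andP[_ /eqP ->].
have letter_le w : w \in W ++ nseq m u -> standard w /\ word_le w u.
  move=> wW; split; first exact: sWu.
  move: wW; rewrite mem_cat mem_nseq => /orP[wW|/andP[_ /eqP ->]].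
    by apply/word_ltW/(allP Wu).
  by rewrite word_le_eqVlt eqxx.
have low_defect w : standard w -> word_le w u -> bideg (left_defect u) (wdeg d w)
    (comul (sl w) - sl w \ox 1 - wg w \ox sl w).
  move=> sw wu; apply: bideg_sub (bideg_comul_super_letter sw) => L R [Lw L0 _].
  have Lu : all (fun v => word_lt v u) L.
    by apply: sub_all Lw => v vw; apply: word_lt_le_trans wu.
  split; first by apply: sub_all Lu => v /word_ltW.
  rewrite (count_memPn _) //; apply/negP => uL.
  by have := allP Lu _ uL; rewrite word_ltxx.
have [|||||||hK hQ] := @bideg_comul_prod (left_defect u)
  (fun L R => all (fun w => word_le w u) L) e _ sWu; try done.
- move=> L1 R1 L2 R2 [L1u d1] L2u; split; first by rewrite all_cat L1u.
  rewrite count_cat sw_deg_cat mulnDl -addSn leq_add // count_letter_deg //.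
- move=> L1 R1 L2 R2 L1u [L2u d2]; split; first by rewrite all_cat L1u.
  by rewrite count_cat sw_deg_cat mulnDl -addnS leq_add // count_letter_deg.
- by move=> L1 R1 L2 R2; rewrite all_cat => -> ->.
- by move=> L R [].
- move=> w /letter_le[sw wu]; rewrite /e; case: eqP => [->|_]; last exact: bideg_right1.
  apply: lin_combD; last exact: bideg_right1.
  by apply: bideg_left => //=; rewrite word_le_eqVlt eqxx.
- move=> w /letter_le[sw wu]; rewrite /e; case: eqP => [->|/eqP wNu].
    by rewrite opprD addrA; apply: low_defect => //; rewrite word_le_eqVlt eqxx.
  rewrite -[comul _ - _](subrK (sl w \ox 1)); apply: lin_combD.
    by rewrite addrAC; apply: low_defect.
  apply: bideg_left => //; split=> /=; first by rewrite wu.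
  by rewrite (negbTE wNu) addn0 mul0n sw_deg1 wdeg_gt0 //; case: sw.
have XY : X * Y = p u u *: (Y * X).
  by rewrite /X /Y !tensM mul1r mulr1 super_letterJ ?tensZl //; apply: grouplike_wg.
have eW : \prod_(w <- W) e w = wg (flatten W) \ox sv W.
  elim: (W) Wu => [|w V IH] /= => [_|/andP[wu Vu]].
    by rewrite big_nil sw_val_nil /word_grouplike big_nil.
  rewrite big_cons IH // wg_cat sw_val_cons -tensM /e.
  by case: eqP wu => // ->; rewrite word_ltxx.
have eu : \prod_(w <- nseq m u) e w = (X + Y) ^+ m.
  by rewrite big_nseq -Monoid.iteropE /e eqxx.
move: hQ; rewrite sw_deg_cat sw_deg_nseq sw_val_cat sw_val_nseq big_cat /= eW eu.
rewrite (tens_gauss_expansion m XY) => /(bideg_grouplike gh).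
rewrite mulrBr -{1}(proj1 gh) -rmorphM [X in _ - X]mulrA tensM mulr_sumr => {}hQ.
rewrite (_ : \sum_(s < m.+1) _ = \sum_(s < m.+1) (h * wg (flatten W)) \ox (h * sv W) *
  (gauss_binomial (p u u) m s *: (Y ^+ (m - s) * X ^+ s))) //.
apply: eq_bigr => s _; rewrite -tens_scalerAr /X /Y !tens_expr !tensM expr1n mulr1.
by rewrite !mulrA.
Qed.

(** * Splitting off the power of the greatest letter *)

Definition powers (l : seq (word * nat)) : seq word :=
  flatten [seq nseq q.2 q.1 | q <- l].

Lemma sw_val_powers l : sv (powers l) = pbw_val l.
Proof.
elim: l => [|q l IH]; first by rewrite sw_val_nil /pbw_val big_nil.
by rewrite /powers /= sw_val_cat -/(powers l) IH sw_val_nseq /pbw_val big_cons.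
Qed.

Lemma sw_deg_powers l : deg (powers l) = pbw_deg l.
Proof.
elim: l => [|q l IH]; first by rewrite sw_deg0 /pbw_deg big_nil.
by rewrite /powers /= sw_deg_cat -/(powers l) IH sw_deg_nseq /pbw_deg big_cons.
Qed.

Lemma mem_powers w l : w \in powers l -> w \in [seq q.1 | q <- l].
Proof.
move=> /flattenP[_ /mapP[q ql ->]]; rewrite mem_nseq => /andP[_ /eqP ->].
exact: map_f.
Qed.

Lemma is_super_word_powers l : pbw l -> is_super_word (powers l).
Proof. by move=> [_ hl] w /mem_powers /mapP[q /hl[[sq _] _ _] ->]. Qed.

Lemma below_powers u l : below u l -> all (fun w => word_lt w u) (powers l).
Proof. by move=> lu; apply/allP => w /mem_powers /mapP[q /(allP lu) qu ->]. Qed.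

Definition exponent u (l : seq (word * nat)) := (\sum_(q <- l | q.1 == u) q.2)%N.
Definition lower_part u (l : seq (word * nat)) := [seq q <- l | word_lt q.1 u].

Lemma exponent_below u l : below u l -> exponent u l = 0%N.
Proof.
move=> lu; rewrite /exponent big_seq_cond big1 // => q /andP[ql /eqP qu].
by have := allP lu _ ql; rewrite qu word_ltxx.
Qed.

Lemma lower_part_below u l : below u l -> lower_part u l = l.
Proof. by move=> lu; apply/all_filterP. Qed.

Lemma exponent_add u m l : below u l -> exponent u (add_power u m l) = m.
Proof.
move=> lu; case: m => [|m] /=; first exact: exponent_below.
by rewrite /exponent -cats1 big_cat -/(exponent u l) exponent_below //= big_cons big_nil eqxx addn0.
Qed.

Lemma lower_part_add u m l : below u l -> lower_part u (add_power u m l) = l.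
Proof.
move=> lu; case: m => [|m] /=; first exact: lower_part_below.
by rewrite /lower_part filter_rcons /= word_ltxx -/(lower_part u l) lower_part_below.
Qed.

Lemma add_power_split u l : pbw l -> all (fun w => word_le w u) [seq q.1 | q <- l] ->
  l = add_power u (exponent u l) (lower_part u l) /\ below u (lower_part u l).
Proof.
move=> [sl' hl] lu; split; last exact: filter_all.
case/lastP: l sl' hl lu => [|l q]; first by rewrite /exponent big_nil.
rewrite map_rcons -cats1 (sorted_pairwise word_lt_rev_trans) pairwise_cat all_cat.
rewrite /= andbT => /andP[lq _] hl /andP[lu qu].
have {}lq : below q.1 l.
  by apply/allP => t tl; move: lq; rewrite allrel1r => /allP; apply; apply: map_f.
have [_ q2 _] : [/\ hard q.1, (0 < q.2)%N & lt_height q.1 q.2].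
  by apply: hl; rewrite mem_rcons inE eqxx.
case: q => w [//|e] /= in lq qu q2 hl *.
have [wu|wu] := eqVneq w u.
  rewrite wu in lq *.
  have -> : rcons l (u, e.+1) = add_power u e.+1 l by [].
  by rewrite exponent_add // lower_part_add.
have lu' : below u (rcons l (w, e.+1)).
  rewrite /below all_rcons /=; move: qu; rewrite andbT word_le_eqVlt (negbTE wu) /= => wlt.
  by rewrite wlt; apply: sub_all lq => t /= /word_lt_trans; apply.
by rewrite exponent_below // lower_part_below.
Qed.

Lemma pbw_lower_part u l : pbw l -> pbw (lower_part u l).
Proof.
move=> [sl' hl]; split=> [|q]; last by rewrite mem_filter => /andP[_ /hl].
have -> : [seq q.1 | q <- lower_part u l] =
    filter (fun w => word_lt w u) [seq q.1 | q <- l] by rewrite filter_map.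
exact: sorted_filter word_lt_rev_trans _ _ sl'.
Qed.

Lemma lt_height_le u m m' : (m <= m')%N -> lt_height u m' -> lt_height u m.
Proof. by rewrite /Defs.lt_height; case: Defs.height => // h mm'; apply: leq_ltn_trans. Qed.

(** * Functionals dual to powers of a super-letter *)

Definition pbw_others m h l x := exists h' l', [/\ grouplike h', pbw l',
  (pbw_deg l' <= m)%N, (h', l') != (h, l) & x = h' * pbw_val l'].
(** Independence up to degree [m], in the form from which [separating_functional] yields dual
    functionals. *)
Definition pbw_free m := forall h l, grouplike h -> pbw l -> (pbw_deg l <= m)%N ->
  ~ lin_comb (pbw_others m h l) (h * pbw_val l).

(* phi is the coefficient of h0 [u]^s, at least on the terms of degree at most *)
(* s deg(u) that occur on the left of a coproduct. *)
Definition coefficient_functional (phi : H -> k) u s h0 :=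
  [/\ scalar phi, phi (h0 * sl u ^+ s) = 1,
      forall h, grouplike h -> h != h0 -> phi (h * sl u ^+ s) = 0,
      forall x, low (s * wdeg d u) x -> phi x = 0 &
      forall h L R, grouplike h -> is_super_word L -> left_defect u L R ->
        deg L = (s * wdeg d u)%N -> phi (h * sv L) = 0].

(** Take phi dual to h0 [u]^s among the restricted words of degree at most s deg(u); it kills lower
    degrees because these are spanned by other such words. A left factor with [left_defect] and
    degree s deg(u) has fewer than s letters u. Reduction does not increase that number, so [u]^s
    cannot arise from it. *)
Lemma coefficient_functional_exists u s h0 : hard u -> (0 < s)%N -> lt_height u s ->
  grouplike h0 -> pbw_free (s * wdeg d u) ->
  exists phi, coefficient_functional phi u s h0.
Proof.
move=> hu s0 hs gh0 free; have [su _] := hu.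
have u0 : (0 < wdeg d u)%N by apply: wdeg_gt0; case: su.
set D := (s * wdeg d u)%N in free *; pose l0 := [:: (u, s)].
have l0E h : h * sl u ^+ s = h * pbw_val l0 by rewrite /pbw_val big_seq1.
have pl0 : pbw l0 by split=> // q; rewrite inE => /eqP ->.
have dl0 : pbw_deg l0 = D by rewrite /pbw_deg big_seq1.
have [phi [lphi phi1 phi0]] := separating_functional (lin_comb_subspace _)
  (free h0 l0 gh0 pl0 (eq_leq dl0)).
have phi_low x : low D x -> phi x = 0.
  move=> /low_pbw hx; apply: phi0; apply: lin_comb_sub hx.
  move=> y [h [l [gh pl dl ->]]]; exists h, l; split=> //; first exact: ltnW.
  by apply/eqP => -[_ ll0]; move: dl; rewrite ll0 dl0 ltnn.
exists phi; split=> //; first by rewrite l0E.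
- move=> h gh hh0; rewrite l0E; apply/phi0/lin_comb_incl; exists h, l0.
  by split=> //; [rewrite dl0|apply: contra hh0 => /eqP[->]].
move=> h L R gh sL [Lu defect] dL.
have red_lt D' v : (D' < D)%N -> reducible D' v by move=> _; apply: reducible_all.
have redD : reducible D u by apply: reducible_all.
have := reduce_power su red_lt redD sL Lu dL.
suff P y : reduced_pow D u (count_mem u L) y -> phi (h * y) = 0.
  apply: (lin_comb_ind (T := fun y => phi (h * y) = 0)) => //.
  apply: (@subspace_preim _ _ k^o (fun y => phi (h * y)) (fun c => c = 0)).
    by move=> c x y; rewrite mulrDr -scalerAr lphi.
  by split=> // c x y -> ->; rewrite scaler0 addr0.
case=> [[l [j [pl lu dl jL ->]]]|lowy]; last first.
  by apply/phi_low/low_mulg => //; apply: lin_comb_incl.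
apply/phi0/lin_comb_incl; exists h, (add_power u j l); split=> //; first by rewrite dl.
apply/eqP => -[_ ll0].
have js : j = s by rewrite -(exponent_add j lu) ll0 /exponent big_cons big_nil eqxx addn0.
move: defect; rewrite dL /D ltn_mul2r u0 /= => /(leq_ltn_trans jL).
by rewrite js ltnn.
Qed.

(** Left factors of degree below D are killed by phi, and those of degree above D leave a right
    factor of degree below m - D. Only left degree D needs the assumption on [Q]. *)
Lemma evall_bidegree (phi : H -> k) (Q : seq word -> seq word -> Prop) D M m t :
  scalar phi -> (M <= m)%N -> (forall x, low D x -> phi x = 0) ->
  (forall h L R, grouplike h -> is_super_word L -> Q L R -> (deg L + deg R = M)%N ->
     deg L = D -> (M < m)%N \/ phi (h * sv L) = 0) ->
  bideg Q M t -> low (m - D) (tensor_evall phi t).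
Proof.
move=> lphi Mm phi0 hQ; apply: lin_comb_map => [|s]; first exact: tensor_evall_linear.
move=> [h [h' [L [R [[gh gh' sL sR] [q dLR ->]]]]]]; rewrite tensor_evallE //.
have [lt_LD|lt_DL|LD] := ltngtP (deg L) D.
- rewrite phi0 ?scale0r; first exact: lin_comb0.
  by apply: lin_comb_incl; exists h, L.
- apply/lin_combZ/lin_comb_incl; exists h', R; split=> //; lia.
have [lt_Mm|->] := hQ _ _ _ gh sL q dLR LD; last by rewrite scale0r; apply: lin_comb0.
apply/lin_combZ/lin_comb_incl; exists h', R; split=> //; lia.
Qed.

Lemma evall_lower phi u s h0 h W m : coefficient_functional phi u s h0 ->
  grouplike h -> is_super_word W -> (deg W < m)%N ->
  low (m - s * wdeg d u) (tensor_evall phi (comul (h * sv W))).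
Proof.
move=> [lphi _ _ phi0 _] gh sW Wm.
by apply: evall_bidegree (bideg_comul gh sW) => //; [exact: ltnW|left].
Qed.

(** In the sum of [comul_leading], phi kills the indices i < s, the indices i > s leave a right
    factor of too small degree, and i = s survives exactly when its left prefix is h0. *)
Lemma evall_leading phi u s h0 h W e m : coefficient_functional phi u s h0 ->
  standard u -> grouplike h -> is_super_word W -> all (fun w => word_lt w u) W ->
  (deg W + e * wdeg d u = m)%N ->
  low (m - s * wdeg d u) (tensor_evall phi (comul (h * (sv W * sl u ^+ e)))
    - (if (s <= e)%N && (h * wg (flatten W) * wg u ^+ (e - s) == h0)
       then gauss_binomial (p u u) e s else 0) *: (h * (sv W * sl u ^+ (e - s)))).
Proof.
move=> hphi su gh sW Wu dW; have [lphi phi1 phi_neq phi_low phi_defect] := hphi.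
have u0 : (0 < wdeg d u)%N by apply: wdeg_gt0; case: su.
set D := (s * wdeg d u)%N; set S := (X in X *: _).
set f := tensor_evall phi; have lf : linear f by apply: tensor_evall_linear.
have := comul_leading e su sW Wu gh; rewrite dW; set t := \sum_(i < e.+1) _ => ht.
have h1 : low (m - D) (f (comul (h * (sv W * sl u ^+ e)) - t)).
  apply: evall_bidegree ht => // h' L R gh' sL hL _ dL.
  by right; apply: phi_defect hL dL.
rewrite -[f _](subrK (f t)) -addrA; apply: lin_combD.
  by rewrite -(linear_atB _ _ lf).
pose y i := h * (sv W * sl u ^+ (e - i)).
pose G i := h * wg (flatten W) * wg u ^+ (e - i).
have gG i : grouplike (G i).
  apply: grouplikeM; first by apply: grouplikeM => //; apply: grouplike_wg.
  elim: (e - i)%N => [|j IH]; first exact: grouplike1.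
  by rewrite exprS; apply: grouplikeM => //; apply: grouplike_wg.
have -> : f t = \sum_(i < e.+1) gauss_binomial (p u u) e i *: (phi (G i * sl u ^+ i) *: y i).
  rewrite (linear_sumZ _ _ _ lf); apply: eq_bigr => i _.
  by rewrite /f tensor_evallE.
have low_i (i : nat) : (i <= e)%N -> i != s -> low (m - D) (phi (G i * sl u ^+ i) *: y i).
  move=> ie; case: ltngtP => // [lt_is|lt_si] _.
    rewrite phi_low ?scale0r; first exact: lin_comb0.
    apply: lin_comb_incl; exists (G i), (nseq i u); rewrite sw_val_nseq sw_deg_nseq.
    by split=> //; [move=> v; rewrite mem_nseq => /andP[_ /eqP ->]|rewrite ltn_mul2r u0].
  apply/lin_combZ/lin_comb_incl; exists h, (W ++ nseq (e - i) u).
  rewrite sw_val_cat sw_val_nseq sw_deg_cat sw_deg_nseq -dW; split=> //.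
    by apply/is_super_word_cat; split=> // v; rewrite mem_nseq => /andP[_ /eqP ->].
  have le_se : (s * wdeg d u <= e * wdeg d u)%N.
    by rewrite leq_mul2r (leq_trans (ltnW lt_si) ie) orbT.
  rewrite /D -(addnBA _ le_se) ltn_add2l -mulnBl ltn_mul2r u0 /=; lia.
have [se|es] := leqP s e; last first.
  rewrite /S leqNgt es scale0r subr0; apply: subspace_sum => [|i _]; first exact: lin_comb_subspace.
  by apply/lin_combZ/low_i; [rewrite -ltnS|rewrite ltn_eqF // (leq_ltn_trans _ es) // -ltnS].
rewrite (bigD1 (inord s)) //= inordK ?ltnS // addrAC; apply: lin_combD.
  rewrite /S se /= -/(G s); case: eqP => [Gs|/eqP Gs].
    by rewrite Gs phi1 scale1r subrr; apply: lin_comb0.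
  by rewrite phi_neq // !scale0r scaler0 subr0; apply: lin_comb0.
apply: subspace_sum => [|i is_]; first exact: lin_comb_subspace.
apply/lin_combZ/low_i; first by rewrite -ltnS.
by apply: contra is_ => /eqP i_s; apply/eqP/val_inj; rewrite /= inordK ?ltnS.
Qed.

Lemma low_pbw_others m M h l x : (m <= pbw_deg l)%N -> (m <= M)%N ->
  low m x -> lin_comb (pbw_others M h l) x.
Proof.
move=> ml mM /low_pbw; apply: lin_comb_sub => y [h' [l' [gh' pl' dl' ->]]].
exists h', l'; split=> //; first by rewrite ltnW // (leq_trans dl').
by apply/eqP => -[_ ll']; move: (leq_trans dl' ml); rewrite ll' ltnn.
Qed.

(** * Relations with terms of top degree m *)

Section Relation.
Variables (m : nat) (r : seq (H * seq (word * nat))) (c : H * seq (word * nat) -> k).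
Hypothesis free : forall m', (m' < m)%N -> pbw_free m'.
Hypothesis r_uniq : uniq r.
Hypothesis r_pbw : forall i, i \in r -> [/\ grouplike i.1, pbw i.2 & (pbw_deg i.2 <= m)%N].
Hypothesis r_coef : forall i, i \in r -> c i != 0.
Hypothesis r_sum : \sum_(i <- r) c i *: (i.1 * pbw_val i.2) = 0.

Variable u : word.
Hypothesis u_hard : hard u.
Hypothesis u_max : forall i, i \in r -> pbw_deg i.2 = m ->
  all (fun w => word_le w u) [seq q.1 | q <- i.2].

Local Notation ex i := (exponent u i.2).
Local Notation lo i := (lower_part u i.2).

Lemma relation_split i : i \in r -> pbw_deg i.2 = m ->
  [/\ i.2 = add_power u (ex i) (lo i), below u (lo i), pbw (lo i),
      (pbw_deg (lo i) + ex i * wdeg d u = m)%N & (0 < ex i)%N -> lt_height u (ex i)].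
Proof.
move=> ir dm; have [_ pi _] := r_pbw ir; have [iE lu] := add_power_split pi (u_max ir dm).
split=> //; [exact: pbw_lower_part|by rewrite -pbw_deg_add -iE|move=> e0].
have [_ /(_ (u, ex i))[]//] := pi.
by rewrite iE exponent_add //; case: (ex i) e0 => // e _; rewrite mem_rcons inE eqxx.
Qed.

(** Since s deg(u) < m, a functional for [u]^s exists by induction. It turns the relation into one
    of degree m - s deg(u), in which term i carries c_i times the Gauss binomial. Distinct terms
    stay distinct, so independence in this smaller degree makes that coefficient vanish. *)
Lemma relation_gauss_binomial i s : i \in r -> pbw_deg i.2 = m ->
  (0 < s <= ex i)%N -> (s * wdeg d u < m)%N -> gauss_binomial (p u u) (ex i) s = 0.
Proof.
move=> ir dm /andP[s0 se] sm; apply/eqP/negPn/negP => nz.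
have [su _] := u_hard; have u0 : (0 < wdeg d u)%N by apply: wdeg_gt0; case: su.
(* [hh j] is the group-like in front of [u]^s on the left of the coproduct of term j, [y j] the
   matching right factor, and [kap j] the coefficient with which it survives. *)
pose hh j := j.1 * wg (flatten (powers (lo j))) * wg u ^+ (ex j - s).
pose y j := j.1 * pbw_val (add_power u (ex j - s) (lo j)).
pose kap j := if [&& pbw_deg j.2 == m, (s <= ex j)%N & hh j == hh i]
  then gauss_binomial (p u u) (ex j) s else 0.
have ghh : grouplike (hh i).
  have [gi _ _] := r_pbw ir.
  apply: grouplikeM; first by apply: grouplikeM => //; apply: grouplike_wg.
  elim: (ex i - s)%N => [|j IH]; first exact: grouplike1.
  by rewrite exprS; apply: grouplikeM => //; apply: grouplike_wg.
have [iE lui pli di hti] := relation_split ir dm.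
have [phi hphi] := coefficient_functional_exists u_hard s0
  (lt_height_le se (hti (leq_trans s0 se))) ghh (free sm).
have [lphi _ _ _ _] := hphi.
pose f x := tensor_evall phi (comul x).
have lf : linear f.
  by move=> e x x'; rewrite /f comul_linear; apply: tensor_evall_linear.
pose D := (s * wdeg d u)%N.
have f_term j : j \in r -> low (m - D) (f (j.1 * pbw_val j.2) - kap j *: y j).
  move=> jr; have [gj pj dj] := r_pbw jr; rewrite /kap.
  case: eqP => [djm|/eqP djm] /=; last first.
    rewrite scale0r subr0 -sw_val_powers.
    apply: (evall_lower hphi gj (is_super_word_powers pj)).
    by rewrite sw_deg_powers ltn_neqAle djm.
  have [jE luj plj dj' _] := relation_split jr djm.
  have -> : pbw_val j.2 = sv (powers (lo j)) * sl u ^+ ex j.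
    by rewrite {1}jE pbw_val_add sw_val_powers.
  have -> : y j = j.1 * (sv (powers (lo j)) * sl u ^+ (ex j - s)).
    by rewrite /y pbw_val_add sw_val_powers.
  apply: (evall_leading hphi su gj (is_super_word_powers plj) (below_powers luj)).
  by rewrite sw_deg_powers.
have sum_low : low (m - D) (\sum_(j <- r) (c j * kap j) *: y j).
  have E : \sum_(j <- r) c j *: (f (j.1 * pbw_val j.2) - kap j *: y j) =
      - \sum_(j <- r) (c j * kap j) *: y j.
    under eq_bigr => j _ do rewrite scalerBr scalerA.
    rewrite sumrB -(linear_sumZ _ _ _ lf) r_sum.
    by rewrite (linear_at0 lf) add0r.
  rewrite -[X in low _ X]opprK -E; apply: subspaceN; first exact: lin_comb_subspace.
  apply: subspace_sum_seq => [|j jr]; first exact: lin_comb_subspace.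
  by apply/lin_combZ/f_term.
have kapi : kap i = gauss_binomial (p u u) (ex i) s by rewrite /kap dm se !eqxx.
have dy : pbw_deg (add_power u (ex i - s) (lo i)) = (m - D)%N.
  by rewrite pbw_deg_add /D mulnBl -di addnBA // leq_mul2r se orbT.
have py j : j \in r -> pbw_deg j.2 = m -> pbw (add_power u (ex j - s) (lo j)).
  move=> jr djm; have [_ luj plj _ htj] := relation_split jr djm.
  apply: pbw_add => // e0; split=> //.
  apply: lt_height_le (leq_subr s _) (htj _); lia.
have [gi _ _] := r_pbw ir.
have := @free (m - D)%N _ i.1 _ gi (py i ir dm); rewrite dy leqnn; apply=> //.
  by rewrite ltn_subrL muln_gt0 s0 u0 (leq_trans _ sm).
rewrite -/(y i).
have ck0 : c i * kap i != 0 by rewrite mulf_neq0 ?kapi //; apply: r_coef.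
apply: (subspace_unscale (lin_comb_subspace _) ck0).
have := sum_low; rewrite (bigD1_seq i) //= => hlow.
apply: (subspaceDl (y := \sum_(j <- r | j != i) (c j * kap j) *: y j)).
- exact: lin_comb_subspace.
- rewrite -big_filter; apply: subspace_sum_seq => [|j]; first exact: lin_comb_subspace.
  rewrite mem_filter => /andP[ji jr].
  rewrite /kap; case: ifP => [/and3P[/eqP djm sj _]|_]; last first.
    by rewrite mulr0 scale0r; apply: lin_comb0.
  have [jE luj plj dj _] := relation_split jr djm; have [gj _ _] := r_pbw jr.
  apply/lin_combZ/lin_comb_incl; exists j.1, (add_power u (ex j - s) (lo j)).
  split=> //; first exact: py.
    by rewrite pbw_deg_add /D mulnBl -dj addnBA // leq_mul2r sj orbT.
  (* The prefix, the lower part and the exponent minus s determine j, because s is at most the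
     exponent. *)
  apply: contra ji => /eqP[h1 E]; apply/eqP; rewrite [j]surjective_pairing [i]surjective_pairing.
  have ej : (ex j - s = ex i - s)%N.
    by rewrite -(exponent_add (ex j - s) luj) E exponent_add.
  have lj : lo j = lo i by rewrite -(lower_part_add (ex j - s) luj) E lower_part_add.
  have exE : ex j = ex i by rewrite -(subnK sj) ej subnK.
  have -> : j.2 = i.2 by rewrite {}jE {}iE exE lj.
  by rewrite h1.
- by apply: low_pbw_others hlow; rewrite ?dy.
Qed.

End Relation.

Lemma evalr_bidegree (phi : H -> k) (Q : seq word -> seq word -> Prop) M m t :
  scalar phi -> (forall L R, Q L R -> (deg L + deg R = M)%N -> (deg L < m)%N) ->
  bideg Q M t -> low m (tensor_evalr phi t).
Proof.
move=> lphi hQ; apply: lin_comb_map => [|s]; first exact: tensor_evalr_linear.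
move=> [h [h' [L [R [[gh gh' sL sR] [q dLR ->]]]]]]; rewrite tensor_evalrE //.
by apply/lin_combZ/lin_comb_incl; exists h, L; split=> //; apply: hQ dLR.
Qed.

Lemma pbw_deg_eq0 l : pbw l -> pbw_deg l = 0%N -> l = [::].
Proof.
case: l => // q l [_ /(_ q)]; rewrite inE eqxx => /(_ isT)[[[/wdeg_gt0 q0 _] _] q2 _].
rewrite /pbw_deg big_cons => /eqP; rewrite addn_eq0 muln_eq0.
by rewrite (gtn_eqF q2) (gtn_eqF q0).
Qed.

(* The component of bidegree (m, 0) of the coproduct separates the group-like *)
(* prefixes. *)
Lemma relation_prefix m (r : seq (H * seq (word * nat))) c h :
  (forall i, i \in r -> [/\ grouplike i.1, pbw i.2 & (pbw_deg i.2 <= m)%N]) ->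
  \sum_(i <- r) c i *: (i.1 * pbw_val i.2) = 0 -> grouplike h ->
  low m (\sum_(i <- r | (pbw_deg i.2 == m) && (i.1 == h)) c i *: pbw_val i.2).
Proof.
move=> r_pbw r_sum gh.
have [phi [lphi phi1 phi0]] := separating_functional (lin_comb_subspace _)
  (grouplike_independent gh).
pose f x := tensor_evalr phi (comul x).
have lf : linear f.
  by move=> e x x'; rewrite /f comul_linear; apply: tensor_evalr_linear.
have f_term j : j \in r -> low m (f (j.1 * pbw_val j.2) -
    (if (pbw_deg j.2 == m) && (j.1 == h) then j.1 * pbw_val j.2 else 0)).
  move=> jr; have [gj pj dj] := r_pbw _ jr; have sj := is_super_word_powers pj.
  rewrite -sw_val_powers; case: eqP => [djm|/eqP djm] /=; last first.
    rewrite subr0; apply: evalr_bidegree (bideg_comul gj sj) => // L R _.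
    rewrite sw_deg_powers => dLR; rewrite (leq_ltn_trans (leq_addr (deg R) _)) // dLR.
    by rewrite ltn_neqAle djm.
  set x := j.1 * sv _.
  have -> : f x - (if j.1 == h then x else 0) = tensor_evalr phi (comul x - x \ox j.1).
    rewrite (linear_atB _ _ (tensor_evalr_linear lphi)) tensor_evalrE //.
    by case: eqP => [->|/eqP jh]; rewrite ?phi1 ?scale1r // phi0 ?scale0r //;
      apply: lin_comb_incl; split=> //; apply/eqP.
  apply: evalr_bidegree (bideg_comul_right gj sj) => // L R.
  by rewrite sw_deg_powers djm; lia.
have hlow : low m (\sum_(i <- r | (pbw_deg i.2 == m) && (i.1 == h)) c i *: (h * pbw_val i.2)).
  have E : \sum_(j <- r) c j *: (f (j.1 * pbw_val j.2) -
      (if (pbw_deg j.2 == m) && (j.1 == h) then j.1 * pbw_val j.2 else 0)) =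
      - \sum_(i <- r | (pbw_deg i.2 == m) && (i.1 == h)) c i *: (h * pbw_val i.2).
    under eq_bigr => j _ do rewrite scalerBr.
    rewrite sumrB -(linear_sumZ _ _ _ lf) r_sum (linear_at0 lf) add0r [in RHS]big_mkcond.
    by congr (- _); apply: eq_bigr => j _; case: andP => [[_ /eqP ->]|_]; rewrite ?scaler0.
  rewrite -[X in low _ X]opprK -E; apply: subspaceN; first exact: lin_comb_subspace.
  apply: subspace_sum_seq => [|j jr]; first exact: lin_comb_subspace.
  by apply/lin_combZ/f_term.
(* The antipode of h is its inverse and removes the common prefix h. *)
have := low_mulg (grouplike_antipode gh) hlow; rewrite mulr_sumr.
under eq_bigr => j _ do rewrite -scalerAr mulrA antipode_grouplikel // mul1r.
by [].
Qed.

(** Let u be the greatest letter in the terms of degree m. The terms containing u are pure powers g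
    [u]^N with N deg(u) = m, and the relation restricted to one prefix writes [u]^N by lower terms.
    For N = 1 this contradicts hardness. For N > 1 the vanishing Gauss binomials make N satisfy the
    height condition, although N is less than the height. *)
Lemma relation_top m (r : seq (H * seq (word * nat))) c : (0 < m)%N ->
  (forall m', (m' < m)%N -> pbw_free m') -> uniq r ->
  (forall i, i \in r -> [/\ grouplike i.1, pbw i.2 & (pbw_deg i.2 <= m)%N]) ->
  (forall i, i \in r -> c i != 0) ->
  \sum_(i <- r) c i *: (i.1 * pbw_val i.2) = 0 ->
  forall i, i \in r -> pbw_deg i.2 != m.
Proof.
move=> m0 free r_uniq r_pbw r_coef r_sum i1 i1r; apply/negP => /eqP di1.
pose letters := flatten [seq [seq q.1 | q <- i.2] | i <- r & pbw_deg i.2 == m].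
have lettersP i w : i \in r -> pbw_deg i.2 = m -> w \in [seq q.1 | q <- i.2] -> w \in letters.
  move=> ir dm wi; apply/flattenP; exists [seq q.1 | q <- i.2] => //.
  by apply/mapP; exists i; rewrite // mem_filter dm eqxx.
have [|u uL u_maxL] := @word_max letters.
  move=> L0; have i10 : i1.2 = [::].
    case E : i1.2 => [//|q l]; have := @lettersP i1 q.1 i1r di1.
    by rewrite E L0 /= inE eqxx => /(_ isT).
  by move: m0; rewrite -di1 i10 /pbw_deg big_nil.
have u_max i : i \in r -> pbw_deg i.2 = m -> all (fun w => word_le w u) [seq q.1 | q <- i.2].
  by move=> ir dm; apply/allP => w /(lettersP _ _ ir dm) /(allP u_maxL).
have [i0 i0r [di0 ui0]] : exists2 i, i \in r & pbw_deg i.2 = m /\ u \in [seq q.1 | q <- i.2].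
  have /flattenP[_ /mapP[i + ->] ui] := uL.
  by rewrite mem_filter => /andP[/eqP dm ir]; exists i.
have hu : hard u.
  by have [_ [_ hl] _] := r_pbw _ i0r; have /mapP[q /hl[hq _ _] ->] := ui0.
have [su nlow] := hu.
have u0 : (0 < wdeg d u)%N by apply: wdeg_gt0; case: su.
have split_i := relation_split r_pbw u_max.
have gauss0 := relation_gauss_binomial free r_uniq r_pbw r_coef r_sum hu u_max.
have pure i : i \in r -> pbw_deg i.2 = m -> (0 < exponent u i.2)%N ->
    (exponent u i.2 * wdeg d u = m)%N /\ lower_part u i.2 = [::].
  move=> ir dm e0; have [_ _ pli di _] := split_i _ ir dm.
  (* If n deg(u) < m for the exponent n, then s = n would be permitted, but the Gauss binomial of
     (n, n) is 1. *)
  have em : (exponent u i.2 * wdeg d u = m)%N.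
    apply/eqP; rewrite eqn_leq -{1}di leq_addl leqNgt; apply/negP => lt_em.
    have := gauss0 _ _ ir dm _ lt_em; rewrite e0 leqnn => /(_ isT) /eqP.
    by rewrite gauss_binomialnn oner_eq0.
  by split=> //; apply: pbw_deg_eq0 => //; lia.
have [i0E lu0 _ _ ht0] := split_i _ i0r di0.
set N := exponent u i0.2 in i0E ht0.
have N0 : (0 < N)%N.
  rewrite lt0n; apply/eqP => e0; move: ui0; rewrite i0E e0 /= => /mapP[q qlo uq].
  by have := allP lu0 _ qlo; rewrite -uq word_ltxx.
have [Nm lo0] := pure _ i0r di0 N0.
have {}i0E : i0.2 = [:: (u, N)] by rewrite i0E lo0; case: (N) N0.
have powN : lin_comb (lower_terms u (N * wdeg d u)) (sl u ^+ N).
  have [gi0 _ _] := r_pbw _ i0r.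
  rewrite Nm; apply: (subspace_unscale (lin_comb_subspace _) (r_coef _ i0r)).
  have := relation_prefix r_pbw r_sum gi0; rewrite -big_filter.
  rewrite (bigD1_seq i0) ?filter_uniq ?mem_filter ?di0 ?eqxx //= i0E /pbw_val big_seq1.
  rewrite -big_filter => hlow; apply: (subspaceDl _ _ (lin_comb_sub _ hlow)).
  - exact: lin_comb_subspace.
  - apply: subspace_sum_seq => [|j]; first exact: lin_comb_subspace.
    rewrite !mem_filter => /andP[ji /andP[/andP[/eqP djm /eqP j1] jr]].
    have [jE luj plj djE _] := split_i _ jr djm.
    (* A term with the same prefix that contains u would again be g [u]^N, hence the term [i0]
       itself. *)
    have j2 : j.2 = lower_part u j.2.
      have [e0|e0] := posnP (exponent u j.2); first by rewrite {1}jE e0.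
      have [ejm loj] := pure _ jr djm e0; move: ji; case/negP; apply/eqP.
      have ejN : exponent u j.2 = N.
        by apply/eqP; rewrite -(eqn_pmul2r u0) ejm Nm.
      rewrite [j]surjective_pairing [i0]surjective_pairing j1 i0E jE loj ejN.
      by case: (N) N0.
    apply/lin_combZ/lin_comb_incl; left; exists (powers (lower_part u j.2)).
    rewrite sw_val_powers -j2; split=> //.
    + by rewrite j2; apply: is_super_word_powers.
    + by rewrite sw_deg_powers.
    + by apply/allP; rewrite j2; apply: below_powers.
  by move=> y [h [W [gh sW dW ->]]]; right; exists h, W.
have [N1|N1] := eqVneq N 1%N.
  by apply: nlow; move: powN; rewrite N1 mul1n expr1.
have [||t [pt Nt]] := @gauss_binomial_vanish _ (p u u) N.
- by rewrite ltn_neqAle eq_sym N1.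
- move=> s /andP[s0 sN]; apply: gauss0 i0r di0 _ _.
    by rewrite s0 ltnW.
  by rewrite -Nm ltn_mul2r u0.
have hN : height_cond a g chi d u N by split=> //; exists t.
have := ht0 N0; rewrite /Defs.lt_height /Defs.height; case: pselect => [exh|[]]; last first.
  by exists N; apply/asboolP.
by case: ex_minnP => j _ /(_ N) min_j; rewrite ltnNge min_j //; apply/asboolP.
Qed.

(** A dependence is a relation with coefficient -1 at (h, l). By [relation_top] it has no terms of
    degree m > 0, so it already holds in degree m - 1. In degree 0 it is a relation between
    group-like elements. *)
Lemma pbw_independent m : pbw_free m.
Proof.
elim/ltn_ind: m => m IH h l gh pl dl hin.
pose f (i : H * seq (word * nat)) := i.1 * pbw_val i.2.
pose P (i : H * seq (word * nat)) :=
  [/\ grouplike i.1, pbw i.2, (pbw_deg i.2 <= m)%N & i != (h, l)].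
have [s [c [us sP E]]] : exists s c, [/\ uniq s, forall i, i \in s -> P i &
    h * pbw_val l = \sum_(i <- s) c i *: f i].
  apply: lin_comb_indexed; apply: lin_comb_sub hin.
  by move=> _ [h' [l' [gh' pl' dl' hl' ->]]]; exists (h', l').
(* [relation_top] requires all coefficients to be non-zero. *)
pose s' := [seq i <- s | c i != 0].
have {}E : h * pbw_val l = \sum_(i <- s') c i *: f i.
  rewrite E big_filter [RHS]big_mkcond; apply: eq_bigr => i _.
  by case: eqP => // ->; rewrite scale0r.
have s'P i : i \in s' -> P i by rewrite mem_filter => /andP[_ /sP].
have hls' : (h, l) \notin s' by apply/negP => /s'P[_ _ _]; rewrite eqxx.
pose e i := if i == (h, l) then -1 else c i.
have e_s' : \sum_(i <- s') e i *: f i = h * pbw_val l.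
  rewrite E big_seq [RHS]big_seq; apply: eq_bigr => i is'.
  by rewrite /e; case: eqP is' => // ->; rewrite (negbTE hls').
have [m0|m0] := posnP m.
  have nil i : pbw i.2 -> (pbw_deg i.2 <= m)%N -> f i = i.1 :> H.
    by rewrite /f m0 leqn0 => pi /eqP /(pbw_deg_eq0 pi) ->; rewrite /pbw_val big_nil mulr1.
  apply: (grouplike_independent gh).
  have hE : h = \sum_(i <- s') c i *: f i by rewrite -E; apply/esym/(nil (h, l)).
  rewrite [X in lin_comb _ X]hE.
  apply: subspace_sum_seq => [|i /s'P[gi pi di ihl]]; first exact: lin_comb_subspace.
  apply/lin_combZ/lin_comb_incl; rewrite nil //; split=> // i1.
  move: ihl; rewrite [i]surjective_pairing i1.
  rewrite (pbw_deg_eq0 pi); last by apply/eqP; rewrite -leqn0 -m0.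
  by rewrite (pbw_deg_eq0 pl) ?eqxx //; apply/eqP; rewrite -leqn0 -m0.
have top := @relation_top m ((h, l) :: s') e m0 IH.
have {}top i : i \in (h, l) :: s' -> (pbw_deg i.2 < m)%N.
  have rP j : j \in (h, l) :: s' -> [/\ grouplike j.1, pbw j.2 & (pbw_deg j.2 <= m)%N].
    by rewrite inE => /orP[/eqP -> //|/s'P[]].
  move=> ir; rewrite ltn_neqAle; have [_ _ ->] := rP _ ir; rewrite andbT.
  apply: top ir => //=.
  - by rewrite hls' filter_uniq.
  - move=> j; rewrite /e inE; case: eqP => [_ _|_ /=]; first by rewrite oppr_eq0 oner_eq0.
    by rewrite mem_filter => /andP[].
  - by rewrite big_cons e_s' /e eqxx scaleN1r addNr.
have hlt : (pbw_deg l < m)%N by apply: (top (h, l)); rewrite inE eqxx.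
have pm : (m.-1 < m)%N by rewrite prednK.
apply: (IH m.-1 pm h l gh pl); first by rewrite -ltnS prednK.
rewrite E; apply: subspace_sum_seq => [|i is']; first exact: lin_comb_subspace.
have [gi pi di ihl] := s'P _ is'.
apply/lin_combZ/lin_comb_incl; exists i.1, i.2; rewrite -surjective_pairing.
by split=> //; rewrite -ltnS prednK // top // inE is' orbT.
Qed.

Lemma pbw_basis
    (H_generated : generates_algebra (fun x : H => grouplike x \/ exists i, x = a i)) :
  is_basis (monotonic_restricted_hard a g chi d) (monotonic_val a g chi).
Proof.
split=> [s c us sP s0 i is_|v].
  (* The sum of all degrees serves as a common bound for them. *)
  apply/eqP/negPn/negP => ci; pose m := (\sum_(j <- s) pbw_deg j.2)%N.
  have deg_le j : j \in s -> (pbw_deg j.2 <= m)%N.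
    by move=> js; rewrite /m (big_rem j) //= leq_addr.
  have [gi si hi] := sP _ is_.
  apply: (@pbw_independent m i.1 i.2 gi (conj si hi) (deg_le _ is_)).
  apply: (subspace_unscale (lin_comb_subspace _) ci).
  apply: (subspaceDl (y := \sum_(j <- s | j != i) c j *: monotonic_val a g chi j)).
  - exact: lin_comb_subspace.
  - rewrite -big_filter; apply: subspace_sum_seq => [|j]; first exact: lin_comb_subspace.
    rewrite mem_filter => /andP[ji js]; have [gj sj hj] := sP _ js.
    apply/lin_combZ/lin_comb_incl; exists j.1, j.2; split=> //; first exact: deg_le.
  - by move: s0; rewrite (bigD1_seq i) //= => ->; apply: lin_comb0.
have [m /low_pbw hv] := low_everything H_generated v.
have [s [c [_ sP ->]]] : exists (s : seq (H * seq (word * nat))) c, [/\ uniq s,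
    forall i, i \in s -> monotonic_restricted_hard a g chi d i &
    v = \sum_(i <- s) c i *: monotonic_val a g chi i].
  apply: lin_comb_indexed; apply: lin_comb_sub hv.
  by move=> _ [h [l [gh [sl' hl] _ ->]]]; exists (h, l).
by exists s, c.
Qed.

End Superwords.

Theorem theorem2 (k : fieldType) (H : hopfAlgType k) (n : nat)
    (a g : 'I_n -> H) (chi : 'I_n -> H -> k) (d : 'I_n -> nat)
    (G_abelian : forall x y : H, grouplike x -> grouplike y -> x * y = y * x)
    (a_semi_inv : forall i : 'I_n,
       skew_primitive_semi_invariant (a i) (g i) (chi i))
    (H_generated : generates_algebra
       (fun x : H => grouplike x \/ exists i : 'I_n, x = a i))
    (d_gt0 : forall i : 'I_n, (0 < d i)%N) :
  is_basis (monotonic_restricted_hard a g chi d) (monotonic_val a g chi).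
Proof. exact: pbw_basis. Qed.
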